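(* There exists $\beta_0\in(0,1)$ such that for all $\beta>\beta_0$ and all $h\neq 0$ there exist $\epsilon>0$ and random vectors $\boldsymbol m_N\in P^1_N$ ($N\in\mathbb N$) such that $$\lim_{N\to\infty}\mathbb P\left(\lambda_1\left(\boldsymbol H(\boldsymbol m_N)\right)>\epsilon\right)=1.$$
   Context: For each $N\in\mathbb N$, $(g_{ij})_{1\le i,j\le N}$ are i.i.d. standard Gaussian random variables on a probability space $(\Omega,\mathcal F,\mathbb P)$, and $\bar g_{ij}=\frac{1}{\sqrt2}(g_{ij}+g_{ji})$. The random vectors $\boldsymbol m_N$ are allowed to depend on the disorder $(g_{ij})$. For $\beta>0$, $h\in\mathbb R$ and $\boldsymbol m=(m_i)\in[-1,1]^N$, the TAP free energy is $$\mathrm{TAP}_N(\boldsymbol m)=\frac{\beta}{\sqrt N}\sum_{1\le i<j\le N}\bar g_{ij}m_im_j+h\sum_{i=1}^N m_i+\frac{\beta^2}{4}N\Big(1-\frac1N\sum_{i=1}^N m_i^2\Big)^2-\sum_{i=1}^N I(m_i),$$ $$I(x)=\frac{1+x}{2}\log(1+x)+\frac{1-x}{2}\log(1-x).$$ Its Hessian is $\boldsymbol H(\boldsymbol m)=\Big(\frac{\partial^2}{\partial m_i\,\partial m_j}\mathrm{TAP}_N(\boldsymbol m)\Big)_{i,j=1}^N$; whenever $\boldsymbol H(\boldsymbol m)$ is evaluated it is tacitly understood that $|m_i|<1$ for all $i$, so that the Hessian exists. The first Plefka condition defines the set $$P^1_N=\Big\{\boldsymbol m\in[-1,1]^N:\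 \frac{\beta^2}{N}\sum_{i=1}^N(1-m_i^2)^2<1\Big\}.$$ $\lambda_1(\boldsymbol M)$ denotes the largest eigenvalue of a real symmetric matrix $\boldsymbol M$. *)

(* Defs.v *)
From HB Require Import structures.
From mathcomp Require Import all_boot all_order all_algebra.
From mathcomp Require Import all_classical all_reals all_analysis.

Set Implicit Arguments.
Unset Strict Implicit.
Unset Printing Implicit Defensive.

Import Order.TTheory GRing.Theory Num.Theory.
Import numFieldNormedType.Exports.

Local Open Scope classical_set_scope.
Local Open Scope ring_scope.

(* Mutual independence of a finite family of real random variables: the product
   rule for every subfamily J and every choice of Borel sets. *)
Definition mutually_independent (d : measure_display) (T : measurableType d)
    (R : realType) (P : probability T R) (I : finType)
    (X : I -> {RV P >-> R}) : Prop :=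
  forall (J : {set I}) (B : I -> set R), (forall i, measurable (B i)) ->
    (P (\bigcap_(i in [set` J]) X i @^-1` B i) =
     \prod_(i in J) P (X i @^-1` B i))%E.

Definition std_gaussian (d : measure_display) (T : measurableType d)
    (R : realType) (P : probability T R) (X : {RV P >-> R}) : Prop :=
  forall A : set R, measurable A -> distribution P X A = normal_prob 0 1 A.

Definition iid_std_gaussian (d : measure_display) (T : measurableType d)
    (R : realType) (P : probability T R) (N : nat)
    (g : 'I_N -> 'I_N -> {RV P >-> R}) : Prop :=
  mutually_independent (fun ij : 'I_N * 'I_N => g ij.1 ij.2) /\
  (forall i j, std_gaussian (g i j)).

(* The library has [ln 0 = 0], hence [TAP_I 1 = TAP_I (-1) = ln 2], in agreement
   with the convention 0 log 0 = 0. *)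
Definition TAP_I (R : realType) (x : R) : R :=
  (1 + x) / 2 * ln (1 + x) + (1 - x) / 2 * ln (1 - x).

Definition gbar (R : realType) (N : nat) (g : 'M[R]_N) (i j : 'I_N) : R :=
  (Num.sqrt 2)^-1 * (g i j + g j i).

Definition TAP (R : realType) (N : nat) (beta h : R) (g : 'M[R]_N)
    (m : 'rV[R]_N) : R :=
  beta / Num.sqrt N%:R *
    (\sum_(i < N) \sum_(j < N | (i < j)%N) gbar g i j * m 0 i * m 0 j)
  + h * (\sum_(i < N) m 0 i)
  + beta ^+ 2 / 4 * N%:R * (1 - N%:R^-1 * \sum_(i < N) m 0 i ^+ 2) ^+ 2
  - \sum_(i < N) TAP_I (m 0 i).

Definition hessian (R : realType) (N : nat) (f : 'rV[R]_N -> R)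
    (x : 'rV[R]_N) : 'M[R]_N :=
  \matrix_(i, j) 'D_(delta_mx 0 i) ('D_(delta_mx 0 j) f) x.

Definition Plefka1 (R : realType) (N : nat) (beta : R) : set 'rV[R]_N :=
  [set m | (forall i, -1 <= m 0 i <= 1) /\
           beta ^+ 2 / N%:R * (\sum_(i < N) (1 - m 0 i ^+ 2) ^+ 2) < 1].

(* For symmetric [M] of positive size the set of eigenvalues is finite and
   nonempty, so that the supremum is its maximum. *)
Definition lambda1 (R : realType) (N : nat) (M : 'M[R]_N) : R :=
  sup [set a : R | eigenvalue M a].

(* Main.v *)
(**
  The Hessian at [m] is [beta] times a Wigner matrix, plus the rank one matrix
  [2 beta^2 / N m^T m], minus a diagonal matrix.  Taking [|m_i|] very close to 1
  outside the first [n ~ (99/100 beta^-1)^2 N] coordinates confines everything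
  to that block and replaces [beta] by a number [y] slightly smaller than 1, for
  which the first Plefka condition holds whatever [m] is on the block.

  With high probability the Wigner matrix [W] of the block has a vector [v]
  with [v^T W v >= (2 - 1/100) |v|^2].  If the l^1 norm of [v] is of order
  [sqrt n |v|], then [m = sign v / 2] makes the rank one term win; otherwise
  [v] is concentrated on few coordinates, and [m] vanishes there and is [3/5]
  on the rest of the block.  As [m] ranges over finitely many profiles, it can
  be chosen measurably.

  For the lower bound on the top eigenvalue: if [W <= x - eta] with [x < 2], then
  [x - W] has a bounded inverse [S]; a Schur complement in each row, together
  with the concentration of the quadratic form of a row in the resolvent of the
  rest, which is independent of that row, gives [x s - s^2 = 1 + o(1)] for
  [s = tr S / n].  This is impossible since [x s - s^2 <= x^2 / 4 < 1].
*)

Require Import Defs.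
From HB Require Import structures.
From mathcomp Require Import all_boot all_order all_algebra.
From mathcomp Require Import all_classical all_reals all_analysis.
From mathcomp Require Import measurable_realfun ring lra.

Set Implicit Arguments.
Unset Strict Implicit.
Unset Printing Implicit Defensive.

Import Order.TTheory GRing.Theory Num.Theory.
Import numFieldNormedType.Exports.

Local Open Scope classical_set_scope.
Local Open Scope ring_scope.

(** * Positive definite matrices and Schur complements *)

(** With [m = 0] on the block and 2 as the top of the spectrum of [W], the form at a top vector [v]
    would be [(2 y - y^2 - 1) |v|^2 = - (1 - y)^2 |v|^2], never positive. So [m] has to be fitted to
    [v], and the two cases are two ways to gain. A spread-out [v] can be correlated with [m], and
    the rank one term then outweighs the cost [v_i^2 / (1 - m_i^2)]. For a concentrated [v] that
    cost is cheap: raising [m_i^2] lowers the average [y^2 / n * sum (1 - m_i^2)], which multiplies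
    all of [|v|^2], while it is paid for only through the small [v_i].

    Both gains are fixed numbers, so the edge 2 is needed only up to 1/100 and crude moment bounds
    suffice. No limiting spectral law has to be established: the contradiction takes place at one
    real [x < 2], where [W <= x - eta] itself supplies every resolvent bound, and second moments of
    the row fluctuations are enough. Spectral statements are phrased through quadratic forms, which
    avoids diagonalisation and makes the events measurable by testing rational vectors. *)

Section Dot.
Variable R : realFieldType.

Definition dot n (u v : 'cV[R]_n) : R := \sum_i u i 0 * v i 0.

Lemma dotE n (u v : 'cV[R]_n) : u^T *m v = (dot u v)%:M.
Proof.
apply/matrixP => i j; rewrite !ord1 !mxE eqxx mulr1n.
by apply: eq_bigr => k _; rewrite !mxE.
Qed.

Lemma dotC n (u v : 'cV[R]_n) : dot u v = dot v u.
Proof. by apply: eq_bigr => k _; rewrite mulrC. Qed.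

Lemma dotDl n (u v w : 'cV[R]_n) : dot (u + v) w = dot u w + dot v w.
Proof. by rewrite -big_split; apply: eq_bigr => k _; rewrite mxE mulrDl. Qed.

Lemma dotDr n (u v w : 'cV[R]_n) : dot u (v + w) = dot u v + dot u w.
Proof. by rewrite dotC dotDl !(dotC u). Qed.

Lemma dotZl n a (u v : 'cV[R]_n) : dot (a *: u) v = a * dot u v.
Proof. by rewrite mulr_sumr; apply: eq_bigr => k _; rewrite mxE mulrA. Qed.

Lemma dotZr n a (u v : 'cV[R]_n) : dot u (a *: v) = a * dot u v.
Proof. by rewrite dotC dotZl dotC. Qed.

Lemma dotNr n (u v : 'cV[R]_n) : dot u (- v) = - dot u v.
Proof. by rewrite -scaleN1r dotZr mulN1r. Qed.

Lemma dotBr n (u v w : 'cV[R]_n) : dot u (v - w) = dot u v - dot u w.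
Proof. by rewrite dotDr dotNr. Qed.

Lemma dotBl n (u v w : 'cV[R]_n) : dot (v - w) u = dot v u - dot w u.
Proof. by rewrite !(dotC _ u) dotBr. Qed.

Lemma dot_ge0 n (u : 'cV[R]_n) : 0 <= dot u u.
Proof. by apply: sumr_ge0 => i _; rewrite -expr2 sqr_ge0. Qed.

Lemma dot_eq0 n (u : 'cV[R]_n) : dot u u = 0 -> u = 0.
Proof.
move=> /eqP; rewrite psumr_eq0 => [/allP h|i _]; last by rewrite -expr2 sqr_ge0.
apply/matrixP => i j; rewrite ord1 mxE; apply/eqP.
by have := h i (mem_index_enum _); rewrite /= -expr2 expf_eq0 /= => ->.
Qed.

Lemma dot_gt0 n (u : 'cV[R]_n) : u != 0 -> 0 < dot u u.
Proof.
move=> u0; rewrite lt_neqAle dot_ge0 andbT eq_sym.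
by apply: contra u0 => /eqP /dot_eq0 ->.
Qed.

Lemma dot_delta n (i : 'I_n) (u : 'cV[R]_n) : dot (delta_mx i 0) u = u i 0.
Proof.
rewrite /dot (bigD1 i) //= big1 => [|j ji]; rewrite !mxE ?eqxx ?mul1r ?addr0//.
by rewrite (negbTE ji) mul0r.
Qed.

Lemma dot_mulmx n (M : 'M[R]_n) (u v : 'cV[R]_n) :
  dot u (M *m v) = dot (M^T *m u) v.
Proof.
have : (dot u (M *m v))%:M = (dot (M^T *m u) v)%:M :> 'M[R]_1.
  by rewrite -!dotE trmx_mul trmxK mulmxA.
by move=> /matrixP /(_ 0 0); rewrite !mxE !eqxx !mulr1n.
Qed.

Lemma dot_mulmxE n (M : 'M[R]_n) (u v : 'cV[R]_n) :
  dot u (M *m v) = \sum_i \sum_j u i 0 * M i j * v j 0.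
Proof.
apply: eq_bigr => i _; rewrite mxE mulr_sumr.
by apply: eq_bigr => j _; rewrite mulrA.
Qed.

Lemma mulmx_delta_col n (M : 'M[R]_n) (i : 'I_n) :
  M *m delta_mx i 0 = col i M.
Proof. by rewrite colE. Qed.

Section Coercive.
Variables (n : nat) (M : 'M[R]_n) (eta : R).
Hypothesis eta_gt0 : 0 < eta.
Hypothesis M_sym : M^T = M.
Hypothesis M_coer : forall v, eta * dot v v <= dot v (M *m v).

Lemma coercive_unitmx : M \in unitmx.
Proof.
rewrite -row_free_unit -kermx_eq0; apply/eqP/row_matrixP => i.
rewrite row0; set r := row i _.
have rM : r *m M = 0 by rewrite -row_mul mulmx_ker row0.
have : dot r^T r^T = 0.
  apply/eqP; rewrite eq_le dot_ge0 andbT.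
  rewrite -(ler_pM2l eta_gt0) mulr0; apply: le_trans (M_coer _) _.
  have -> : M *m r^T = 0 by rewrite -[LHS]trmxK trmx_mul M_sym trmxK rM trmx0.
  by rewrite /dot big1 // => j _; rewrite [X in _ * X]mxE mulr0.
by move/dot_eq0/(congr1 trmx); rewrite trmxK trmx0.
Qed.

Local Notation Ri := (invmx M).

Lemma coercive_inv_sym : Ri^T = Ri.
Proof. by rewrite trmx_inv M_sym. Qed.

(** Coercivity is tested on a column of the inverse, which [M] sends to a basis vector, so that the
    form reduces to a diagonal entry. *)
Lemma coercive_inv_diag k : eta * dot (col k Ri) (col k Ri) <= Ri k k.
Proof.
apply: le_trans (M_coer _) _.
rewrite -mulmx_delta_col mulmxA mulmxV ?coercive_unitmx // mul1mx.
by rewrite dotC dot_delta mulmx_delta_col mxE.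
Qed.

Lemma coercive_inv_diag_ge0 k : 0 <= Ri k k.
Proof.
by apply: le_trans (coercive_inv_diag k); rewrite mulr_ge0 ?dot_ge0 ?ltW.
Qed.

Lemma coercive_inv_col k : dot (col k Ri) (col k Ri) <= eta^-1 ^+ 2.
Proof.
set u := col k Ri.
have Mu : M *m u = delta_mx k 0.
  by rewrite /u -mulmx_delta_col mulmxA mulmxV ?coercive_unitmx // mul1mx.
(* This square plays the role of Cauchy-Schwarz: it gives [2 eta a <= 1 + eta^2 b], and coercivity
   gives [eta b <= a], whence [eta^2 b <= 1]. *)
have : 0 <= dot (M *m u - eta *: u) (M *m u - eta *: u) by exact: dot_ge0.
rewrite dotBr !dotBl !dotZl !dotZr Mu.
have -> : dot (delta_mx k 0) (delta_mx k 0) = 1 :> R.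
  by rewrite dot_delta mxE !eqxx.
rewrite (dotC u (delta_mx _ _)); have := M_coer u; rewrite Mu (dotC u (delta_mx _ _)).
set a := dot (delta_mx k 0) u; set b := dot u u => h1 h2.
have h3 : eta ^+ 2 * b <= 1.
  have := ler_wpM2l (ltW eta_gt0) h1; rewrite expr2 -mulrA. lra.
by rewrite exprVn -[leRHS]mul1r ler_pdivlMr ?exprn_gt0 // mulrC.
Qed.

Lemma coercive_inv_sqr j k : Ri j k ^+ 2 <= eta^-1 ^+ 2.
Proof.
apply: le_trans (coercive_inv_col k).
rewrite /dot (bigD1 j) //= !mxE -expr2 lerDl.
by apply: sumr_ge0 => i _; rewrite -expr2 sqr_ge0.
Qed.

Lemma coercive_inv_sum_sqr :
  \sum_j \sum_k Ri j k ^+ 2 <= n%:R * eta^-1 ^+ 2.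
Proof.
rewrite exchange_big /= -[in leRHS](card_ord n) -sumr_const mulr_suml.
apply: ler_sum => k _; rewrite mul1r; apply: le_trans (coercive_inv_col k).
by apply: ler_sum => j _; rewrite !mxE expr2.
Qed.

End Coercive.

(** Row and column [i] are zeroed rather than removed, so that a matrix and its minors have the same
    size. The price is a spurious entry [x^-1] at [(i, i)] in the resolvent, which is subtracted
    wherever a trace is taken. *)
Definition rcdel n (i : 'I_n) (W : 'M[R]_n) : 'M[R]_n :=
  \matrix_(j, k) if (j == i) || (k == i) then 0 else W j k.

(** For symmetric [W]: the spectrum lies below [c]. *)
Definition rayleigh_le n (c : R) (W : 'M[R]_n) :=
  forall v : 'cV[R]_n, dot v (W *m v) <= c * dot v v.

Lemma rcdel_rayleigh_le n (i : 'I_n) c (W : 'M[R]_n) :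
  0 <= c -> rayleigh_le c W -> rayleigh_le c (rcdel i W).
Proof.
move=> c0 hW v; pose v' : 'cV[R]_n := \col_j if j == i then 0 else v j 0.
have -> : dot v (rcdel i W *m v) = dot v' (W *m v').
  rewrite !dot_mulmxE; apply: eq_bigr => j _; apply: eq_bigr => k _.
  by rewrite !mxE; case: eqP; case: eqP => _ _ /=; rewrite ?(mulr0, mul0r).
apply: le_trans (hW v') _; rewrite ler_wpM2l //.
apply: ler_sum => j _; rewrite !mxE; case: eqP => // _.
by rewrite mul0r -expr2 sqr_ge0.
Qed.

Lemma rcdel_sym n (i : 'I_n) (W : 'M[R]_n) : W^T = W -> (rcdel i W)^T = rcdel i W.
Proof.
move=> hW; apply/matrixP => j k; rewrite !mxE orbC.
by rewrite -[in RHS]hW mxE.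
Qed.

Lemma rayleigh_le_coercive n x eta (W : 'M[R]_n) : rayleigh_le (x - eta) W ->
  forall v, eta * dot v v <= dot v ((x%:M - W) *m v).
Proof.
move=> hW v; rewrite mulmxBl mul_scalar_mx dotBr dotZr.
by have := hW v; rewrite mulrBl; lra.
Qed.

(** The quadratic form of row [i] in the resolvent of its minor, minus the normalised trace. The
    latter is the conditional mean when the row is independent of the minor, with centred,
    independent entries of variance [1/n]. *)
Definition schur_fluct n (x : R) (i : 'I_n) (W : 'M[R]_n) : R :=
  \sum_(j | j != i) \sum_(k | k != i)
    invmx (x%:M - rcdel i W) j k * (W i j * W i k - (j == k)%:R / n%:R).

Section Resolvent.
Variables (n : nat) (W : 'M[R]_n) (x eta : R).
Hypothesis eta_gt0 : 0 < eta.
Hypothesis eta_ltx : eta < x.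
Hypothesis W_sym : W^T = W.
Hypothesis W_diag : forall i, W i i = 0.
Hypothesis W_le : rayleigh_le (x - eta) W.

Let x_gt0 : 0 < x := lt_trans eta_gt0 eta_ltx.
Let M := x%:M - W.
Let Rs := invmx M.
Let M_sym : M^T = M. Proof. by rewrite /M linearB /= tr_scalar_mx W_sym. Qed.
Let M_coer := rayleigh_le_coercive W_le.
Let M_unit : M \in unitmx := coercive_unitmx eta_gt0 M_sym M_coer.

Section Index.
Variable i : 'I_n.
Let M0 := x%:M - rcdel i W.
Let R0 := invmx M0.
Let M0_sym : M0^T = M0.
Proof. by rewrite /M0 linearB /= tr_scalar_mx rcdel_sym. Qed.
Let M0_coer : forall v, eta * dot v v <= dot v (M0 *m v).
Proof.
apply: rayleigh_le_coercive; apply: rcdel_rayleigh_le => //.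
by rewrite subr_ge0 ltW.
Qed.
Let M0_unit : M0 \in unitmx := coercive_unitmx eta_gt0 M0_sym M0_coer.
Let R0_sym : R0^T = R0. Proof. exact: coercive_inv_sym. Qed.
Let e : 'cV[R]_n := delta_mx i 0.
Let w : 'cV[R]_n := col i W.
Let r := R0 *m w.
Let q := dot w r.
Let u := e + r.

Let W_split : W = rcdel i W + (e *m w^T + w *m e^T).
Proof.
apply/matrixP => j k; rewrite !mxE !big_ord1 !mxE !eqxx !andbT.
have := congr1 (fun A : 'M[R]_n => A i k) W_sym; rewrite mxE => hik.
case: (altP (j =P i)) => [->|ji] /=.
  case: (altP (k =P i)) => [->|ki] /=; rewrite ?W_diag //.
    by rewrite mulr0 mul0r !addr0.
  by rewrite hik mul1r mulr0 add0r addr0.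
case: (altP (k =P i)) => [->|ki] /=; first by rewrite mul0r mulr1 !add0r.
by rewrite mul0r mulr0 !addr0.
Qed.

Let M_split : M = M0 - (e *m w^T + w *m e^T).
Proof. by rewrite /M {1}W_split opprD addrA. Qed.

Let M0e : M0 *m e = x *: e.
Proof.
rewrite mulmxBl mul_scalar_mx mulmx_delta_col.
rewrite (_ : col i _ = 0) ?subr0 //.
by apply/matrixP => j k; rewrite !mxE eqxx orbT.
Qed.

Let R0e : R0 *m e = x^-1 *: e.
Proof.
have /(congr1 (fun v => R0 *m v)) := M0e.
rewrite mulmxA mulVmx // mul1mx -scalemxAr => h.
by rewrite [e in RHS]h scalerA mulVf ?scale1r // gt_eqF.
Qed.

Let r_i : r i 0 = 0.
Proof.
rewrite -dot_delta dot_mulmx R0_sym R0e dotZl.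
by rewrite dot_delta mxE W_diag mulr0.
Qed.

(** Gaussian elimination: [u] solves every equation of the system except the one of index [i], whose
    residue [x - q] is the Schur complement. Hence [u] is a multiple of column [i] of the
    inverse. *)
Let Mu : M *m u = (x - q) *: e.
Proof.
rewrite mulmxDr {1}/M mulmxBl mul_scalar_mx mulmx_delta_col -/w.
rewrite M_split mulmxBl mulmxA mulmxV // mul1mx mulmxDl -!mulmxA !dotE.
rewrite dot_delta r_i -/q (_ : 0%:M = 0) ?mulmx0 ?addr0; last first.
  by apply/matrixP => a b; rewrite !mxE mul0rn.
by rewrite mul_mx_scalar scalerBl addrA subrK.
Qed.

Let u_i : u i 0 = 1.
Proof. by rewrite mxE r_i addr0 mxE !eqxx. Qed.

Let u_col : u = (x - q) *: col i Rs.
Proof.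
have /(congr1 (fun v => Rs *m v)) := Mu.
by rewrite mulmxA mulVmx // mul1mx -scalemxAr mulmx_delta_col.
Qed.

Let pivot : (x - q) * Rs i i = 1.
Proof. by move: u_i; rewrite u_col !mxE. Qed.

(** Rank one update from the minor to the full resolvent; the last term removes the spurious entry
    of [R0]. *)
Let Rs_split : Rs = R0 + Rs i i *: (u *m u^T) - x^-1 *: (e *m e^T).
Proof.
apply: (can_inj (mulKmx M_unit)); rewrite mulmxV //.
rewrite mulmxBr mulmxDr -!scalemxAr [M *m (u *m _)]mulmxA Mu.
rewrite -scalemxAl scalerA [Rs i i * _]mulrC pivot scale1r.
rewrite [M *m (e *m _)]mulmxA {2}/M [(_ - W) *m e]mulmxBl mul_scalar_mx mulmx_delta_col -/w.
rewrite [(_ - w) *m _]mulmxBl -scalemxAl scalerBr scalerA mulVf ?gt_eqF // scale1r.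
rewrite M_split mulmxBl mulmxV // mulmxDl -!mulmxA.
have -> : w^T *m R0 = r^T by rewrite /r trmx_mul R0_sym.
have -> : e^T *m R0 = x^-1 *: e^T.
  by rewrite -{1}R0_sym -trmx_mul R0e linearZ.
have uT : u^T = e^T + r^T by rewrite /u linearD.
rewrite -scalemxAr uT mulmxDr.
set A := e *m r^T; set B := w *m e^T; set C := e *m e^T.
by rewrite opprD opprB !addrA; apply/matrixP => a b; rewrite !mxE; ring.
Qed.

Let tr_split : \tr Rs = \tr R0 + Rs i i * dot u u - x^-1.
Proof.
rewrite {1}Rs_split linearB linearD /= !linearZ /=.
rewrite !(mxtrace_mulC _ _^T) !dotE !mxtrace_scalar dot_delta mxE !eqxx !mulr1n.
by rewrite /GRing.scale /= mulrN1.
Qed.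

(** This is [Rs i i * (x - q) = 1] with [q] written as fluctuation plus normalised trace of the
    minor. The number [t] is what the rank one update adds to that trace; its bound does not depend
    on [n], so [t / n] is negligible. *)
Lemma resolvent_step : exists t, [/\ 0 <= t <= eta^-1 &
  Rs i i * (x - schur_fluct x i W - (\tr Rs - t) / n%:R) = 1].
Proof.
have Rii0 : 0 <= Rs i i by exact: (coercive_inv_diag_ge0 eta_gt0 M_sym M_coer).
have Rii_gt0 : 0 < Rs i i.
  rewrite lt_neqAle Rii0 andbT eq_sym; apply/eqP => h.
  by have := pivot; rewrite h mulr0 => /eqP; rewrite eq_sym oner_eq0.
exists (Rs i i * dot u u); split.
  rewrite mulr_ge0 ?dot_ge0 //=.
  (* Here [t] becomes [x - q] times the squared norm of column [i] of the inverse. Coercivity bounds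
     [eta] times that norm by [Rs i i], and the pivot identity turns this into [eta * t <= 1]. *)
  rewrite u_col dotZl dotZr !mulrA [Rs i i * _]mulrC pivot mul1r.
  rewrite -(ler_pM2l eta_gt0) mulfV ?gt_eqF // -pivot mulrCA ler_wpM2l //.
    by rewrite -(pmulr_rge0 _ Rii_gt0) mulrC pivot ler01.
  exact: (coercive_inv_diag eta_gt0 M_sym M_coer).
have R0ii : R0 i i = x^-1.
  have /matrixP /(_ i 0) := R0e.
  by rewrite mulmx_delta_col !mxE !eqxx mulr1.
have -> : schur_fluct x i W = q - (\tr R0 - x^-1) / n%:R.
  have -> : q = \sum_(j | j != i) \sum_(k | k != i) R0 j k * (W i j * W i k).
    rewrite /q dot_mulmxE (bigD1 i) //= big1 ?add0r; last first.
      by move=> k _; rewrite [w i 0]mxE W_diag !mul0r.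
    apply: eq_bigr => j ji; rewrite (bigD1 i) //=.
    rewrite [w i 0]mxE W_diag mulr0 add0r; apply: eq_bigr => k ki.
    rewrite ![w _ 0]mxE -{1 2}W_sym ![W^T _ _]mxE; ring.
  have -> : (\tr R0 - x^-1) / n%:R =
      \sum_(j | j != i) \sum_(k | k != i) R0 j k * ((j == k)%:R / n%:R).
    rewrite /mxtrace (bigD1 i) //= R0ii [x^-1 + _]addrC addrK mulr_suml.
    apply: eq_bigr => j ji; rewrite (bigD1 j) //= eqxx mul1r big1 ?addr0 //.
    by move=> k /andP[_ kj]; rewrite eq_sym (negbTE kj) mul0r mulr0.
  rewrite -sumrB; apply: eq_bigr => j _; rewrite -sumrB.
  by apply: eq_bigr => k _; rewrite mulrBr.
rewrite tr_split -pivot mulrC; congr (_ * _); ring.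
Qed.

End Index.

(* With [s = \tr Rs / n], summing [resolvent_step] over [i] gives the
   approximate semicircle equation [x s - s^2 = 1], whose left side is at most
   [x^2 / 4]. *)
Lemma resolvent_fluct : (0 < n)%N ->
  1 - x ^+ 2 / 4 <= n%:R^-1 * (eta^-1 * \sum_i `|schur_fluct x i W| + eta^-1 ^+ 2).
Proof.
move=> n_gt0; have n0 : 0 < n%:R :> R by rewrite ltr0n.
have [t ht] := choice resolvent_step.
have t0 i : 0 <= t i <= eta^-1 by have [] := ht i.
have tE i : Rs i i * (x - schur_fluct x i W - (\tr Rs - t i) / n%:R) = 1.
  by have [] := ht i.
have Rle i : 0 <= Rs i i <= eta^-1.
  have R0 : 0 <= Rs i i by exact: (coercive_inv_diag_ge0 eta_gt0 M_sym M_coer).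
  rewrite R0 /= -(@ler_pXn2r _ 2) ?nnegrE ?invr_ge0 ?(ltW eta_gt0) //.
  exact: (coercive_inv_sqr eta_gt0 M_sym M_coer).
set s := \tr Rs / n%:R.
have h1 i : Rs i i * (x - s) + Rs i i * (t i / n%:R - schur_fluct x i W) = 1.
  by rewrite -[RHS](tE i) /s; move: (\tr Rs) (Rs i i) (t i) (schur_fluct _ _ _) => a b c f; ring.
have : \sum_i (Rs i i * (x - s) + Rs i i * (t i / n%:R - schur_fluct x i W)) = n%:R.
  by under eq_bigr do rewrite h1; rewrite sumr_const card_ord.
rewrite big_split /= -mulr_suml -/(\tr Rs).
have -> : \tr Rs = s * n%:R by rewrite /s divfK // gt_eqF.
move=> h2.
have h3 : \sum_i Rs i i * (t i / n%:R - schur_fluct x i W) <=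
    eta^-1 * \sum_i `|schur_fluct x i W| + eta^-1 ^+ 2.
  apply: (@le_trans _ _ (\sum_i (eta^-1 * `|schur_fluct x i W| + eta^-1 ^+ 2 / n%:R))).
    apply: ler_sum => i _.
    have /andP[a0 a1] := Rle i; have /andP[b0 b1] := t0 i.
    rewrite mulrBr addrC lerD //.
      apply: le_trans (ler_norm _) _; rewrite normrN normrM (ger0_norm a0).
      by rewrite ler_wpM2r.
    by rewrite mulrA ler_wpM2r ?invr_ge0 ?ler0n // expr2 ler_pM.
  rewrite big_split /= -mulr_sumr lerD2l sumr_const card_ord -[_ *+ n]mulr_natr.
  by rewrite mulfVK // gt_eqF.
have h4 : (1 - x ^+ 2 / 4) * n%:R <= (1 - s * (x - s)) * n%:R.
  rewrite ler_pM2r // lerD2l lerN2; have := sqr_ge0 (s - x / 2); lra.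
rewrite [leRHS]mulrC ler_pdivlMr //; lra.
Qed.

End Resolvent.
End Dot.
(** * Independence *)

Section Independence.
Context d (T : measurableType d) (R : realType) (P : probability T R).

Definition indep_fun (U V : T -> R) := forall A B : set R,
  measurable A -> measurable B ->
  (P (U @^-1` A `&` V @^-1` B) = P (U @^-1` A) * P (V @^-1` B))%E.

(** The law of the pair and the product of the two laws agree on rectangles, hence everywhere.
    Tonelli then yields integrability, and Fubini the factorisation. *)
Lemma indep_fun_integral (U V : {mfun T >-> R}) : indep_fun U V ->
  P.-integrable setT (EFin \o U) -> P.-integrable setT (EFin \o V) ->
  P.-integrable setT (fun t => (U t * V t)%:E) /\
  (\int[P]_t (U t * V t)%:E = \int[P]_t (U t)%:E * \int[P]_t (V t)%:E)%E.
Proof.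
move=> UV iU iV.
have mW : measurable_fun setT (fun t => (U t, V t)) by exact: measurable_fun_pair.
pose W : {mfun T >-> (R * R)%type} := MeasurableFun.Pack
  (MeasurableFun.Class (isMeasurableFun.Build _ _ _ _ _ mW)).
pose PU := distribution P U; pose PV := distribution P V.
pose f (z : R * R) : \bar R := (z.1 * z.2)%:E.
have mf : measurable_fun setT f.
  by apply/measurable_EFinP; apply: measurable_funM => //.
have WE X : measurable X -> (PU \x PV)%E X = distribution P W X.
  by move=> mX; apply: (@product_measure_unique _ _ _ _ _ PU PV (distribution P W)).
have iPV : PV.-integrable setT EFin.
  by apply: integrable_pushforward => //.
have iPU : PU.-integrable setT EFin.
  by apply: integrable_pushforward => //.
have intf : (PU \x PV)%E.-integrable setT f.
  apply/integrableP; split => //.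
  have mabs : measurable_fun setT (fun z => `|f z|)%E by exact: measurableT_comp.
  rewrite (fubini_tonelli1 _ mabs) //=.
  rewrite /fubini_F /=.
  under eq_integral do under eq_integral do rewrite normrM EFinM.
  have mn : measurable_fun setT (EFin \o (fun y : R => `|y|)).
    by apply/measurable_EFinP; exact: measurableT_comp.
  have e1 (x : R) : (\int[PV]_y (`|x|%:E * `|y|%:E) = `|x|%:E * \int[PV]_y `|y|%:E)%E.
    by rewrite ge0_integralZl //; exact: mn.
  under eq_integral do rewrite e1.
  move/integrableP : iPV => [_ iPV]; move/integrableP : iPU => [_ iPU].
  have e3 (c : \bar R) : (0 <= c -> \int[PU]_x (`|x|%:E * c) = \int[PU]_x `|x|%:E * c)%E.
    by move=> c0; apply: ge0_integralZr => //.
  rewrite e3 ?integral_ge0 //.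
  by rewrite lte_mul_pinfty // ?integral_ge0 // ge0_fin_numE // integral_ge0.
have iW : (distribution P W).-integrable setT f.
  apply/integrableP; split => //; move/integrableP : intf => [_].
  rewrite (eq_measure_integral (distribution P W)) //.
  by move=> A mA _; exact: WE.
have iUV : P.-integrable setT (f \o W).
  move/integrableP : iW => [_]; rewrite ge0_integral_distribution //; last first.
    by apply: measurableT_comp.
  by move=> h; apply/integrableP; split => //; apply: measurableT_comp.
split => //.
rewrite -[LHS]/(\int[P]_t (f \o W) t)%E -(integral_distribution mf iUV).
rewrite (eq_measure_integral (PU \x PV)%E); last first.
  by move=> A mA _; apply/esym; exact: WE.
rewrite -integral12_prod_meas1 // /fubini_F /f /=.
have e2 (x : R) : (\int[PV]_y (x * y)%:E = x%:E * \int[PV]_y y%:E)%E.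
  by rewrite -integralZl //; apply: eq_integral => y _; rewrite EFinM.
under eq_integral do rewrite e2.
rewrite -(fineK (integrable_fin_num _ iPV)) // integralZr //.
rewrite fineK ?integrable_fin_num // integral_distribution //.
by congr (_ * _)%E; rewrite integral_distribution.
Qed.

Variables (I : finType) (X : I -> {RV P >-> R}).

Definition cylinders (J : {set I}) : set (set T) := [set E |
  exists B : I -> set R, (forall i, measurable (B i)) /\
    E = \bigcap_(i in [set` J]) X i @^-1` B i].

Lemma cylinders_setI J : setI_closed (cylinders J).
Proof.
move=> _ _ [B [mB ->]] [C [mC ->]]; exists (fun i => B i `&` C i); split.
  by move=> i; exact: measurableI.
by rewrite -bigcapI.
Qed.

Lemma cylinders_measurable J : cylinders J `<=` measurable.
Proof.
move=> _ [B [mB ->]]; apply: fin_bigcap_measurable => // i _.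
by rewrite -[X in measurable X]setTI; exact: measurable_funP.
Qed.

Lemma sigma_cylinders_measurable J : <<s cylinders J >> `<=` measurable.
Proof.
by apply: smallest_sub; [exact: sigma_algebra_measurable|exact: cylinders_measurable].
Qed.

(** Dynkin's theorem: for fixed [F] the events obeying the product rule form a Dynkin system, and
    [G] is stable under intersection. *)
Lemma indep_sigma_gen (G : set (set T)) (F : set T) :
  setI_closed G -> G `<=` measurable -> measurable F ->
  (forall E, G E -> P (E `&` F) = P E * P F)%E ->
  forall E, <<s G >> E -> (P (E `&` F) = P E * P F)%E.
Proof.
move=> GI Gm mF GF E; rewrite -setI_closed_g_dynkin_g_sigma_algebra // => sE.
suff : measurable E /\ (P (E `&` F) = P E * P F)%E by case.
apply: (sE [set E | measurable E /\ (P (E `&` F) = P E * P F)%E]); split; last first.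
  by move=> A GA; split; [exact: Gm|exact: GF].
split.
- by split => //; rewrite setTI probability_setT mul1e.
- move=> A [mA hA]; split; first exact: measurableC.
  rewrite setIC -setDE measureD // ?ltey_eq ?fin_num_measure //.
  transitivity (P F - P A * P F)%E; first by rewrite setIC; congr (_ - _)%E.
  rewrite probability_setC // muleBl ?mul1e ?fin_num_measure //.
- move=> A tA hA; have mA n : measurable (A n) by have [] := hA n.
  split; first exact: bigcup_measurable.
  rewrite setI_bigcupl measure_bigcup //; last 2 first.
  + by move=> i _; exact: measurableI.
  + exact: trivIset_setIr.
  rewrite measure_bigcup //.
  rewrite -[in RHS](fineK (fin_num_measure P F mF)) [RHS]muleC -nneseriesZl //.
  apply: eq_eseriesr => i _; rewrite fineK ?fin_num_measure // muleC.
  by have [] := hA i.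
Qed.

Hypothesis X_indep : mutually_independent X.

Lemma indep_cylinders (J K : {set I}) (E F : set T) : (forall i, i \in J -> i \notin K) ->
  cylinders J E -> cylinders K F -> (P (E `&` F) = P E * P F)%E.
Proof.
move=> JK [B [mB ->]] [C [mC ->]].
pose D i := if i \in J then B i else C i.
have mD i : measurable (D i) by rewrite /D; case: ifP.
have -> : \bigcap_(i in [set` J]) X i @^-1` B i `&`
    \bigcap_(i in [set` K]) X i @^-1` C i =
    \bigcap_(i in [set` (J :|: K)%SET]) X i @^-1` D i.
  apply/seteqP; split => [t [h1 h2] i /=|t h].
    rewrite /D inE; case: ifPn => [iJ _|iJ /= iK]; [exact: h1|exact: h2].
  split => i /= iJ.
    by have := h i; rewrite /= inE iJ /D iJ; exact.
  have iJ' : i \notin J by apply/negP => /JK; rewrite iJ.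
  by have := h i; rewrite /= inE iJ orbT /D (negbTE iJ'); exact.
have dJK : fintype.disjoint (mem J) (mem K).
  apply/pred0P => i /=; apply/negbTE; rewrite negb_and.
  by case: (boolP (i \in J)) => //= /JK.
rewrite !X_indep // (eq_bigl [in [predU J & K]]); last by move=> i; rewrite !inE.
rewrite bigU //; congr (_ * _)%E.
  by apply: eq_bigr => i iJ; rewrite /D iJ.
apply: eq_bigr => i iK; rewrite /D; case: ifP => // iJ.
by move: iK; rewrite (negbTE (JK _ iJ)).
Qed.

(** The product rule is extended from cylinders to the sigma-algebras in one argument at a time. *)
Lemma indep_sigma (J K : {set I}) (E F : set T) : (forall i, i \in J -> i \notin K) ->
  <<s cylinders J >> E -> <<s cylinders K >> F -> (P (E `&` F) = P E * P F)%E.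
Proof.
move=> JK sE sF; apply: indep_sigma_gen sE.
- exact: cylinders_setI.
- exact: cylinders_measurable.
- exact: sigma_cylinders_measurable sF.
move=> {}E cE; rewrite setIC muleC; apply: indep_sigma_gen sF.
- exact: cylinders_setI.
- exact: cylinders_measurable.
- exact: cylinders_measurable cE.
by move=> {}F cF; rewrite setIC muleC; exact: indep_cylinders cE cF.
Qed.

(** Expresses that [f] depends only on the variables in [J]. As ordinary measurability for a smaller
    sigma-algebra, it inherits all closure rules. *)
Definition sigma_measurable (J : {set I}) (f : T -> R) :=
  measurable_fun [set: g_sigma_algebraType (cylinders J)] f.

Lemma sigma_measurable_coord (J : {set I}) i : i \in J -> sigma_measurable J (X i).
Proof.
move=> iJ _ B mB; rewrite setTI; apply: sub_sigma_algebra.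
exists (fun j => if j == i then B else setT); split.
  by move=> j; case: ifP.
apply/seteqP; split => [t Bt j _ /=|t h]; first by case: eqP => [->|].
by have := h i iJ; rewrite /= eqxx.
Qed.

Lemma sigma_measurableT J f : sigma_measurable J f -> measurable_fun setT f.
Proof.
move=> mf _ B mB; rewrite setTI; apply: (@sigma_cylinders_measurable J).
by have := mf measurableT B mB; rewrite setTI.
Qed.

Lemma sigma_measurable_indep (J K : {set I}) (U V : T -> R) : (forall i, i \in J -> i \notin K) ->
  sigma_measurable J U -> sigma_measurable K V -> indep_fun U V.
Proof.
move=> JK mU mV A B mA mB; apply: indep_sigma JK _ _.
  by have := mU measurableT A mA; rewrite setTI.
by have := mV measurableT B mB; rewrite setTI.
Qed.

Lemma sigma_measurable_integral (J K : {set I}) (U V : T -> R) :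
  (forall i, i \in J -> i \notin K) ->
  sigma_measurable J U -> sigma_measurable K V ->
  P.-integrable setT (EFin \o U) -> P.-integrable setT (EFin \o V) ->
  P.-integrable setT (fun t => (U t * V t)%:E) /\
  (\int[P]_t (U t * V t)%:E = \int[P]_t (U t)%:E * \int[P]_t (V t)%:E)%E.
Proof.
move=> JK sU sV; have UV := sigma_measurable_indep JK sU sV.
have mU := sigma_measurableT sU; have mV := sigma_measurableT sV.
pose U' : {mfun T >-> R} := MeasurableFun.Pack
  (MeasurableFun.Class (isMeasurableFun.Build _ _ _ _ _ mU)).
pose V' : {mfun T >-> R} := MeasurableFun.Pack
  (MeasurableFun.Class (isMeasurableFun.Build _ _ _ _ _ mV)).
exact: (@indep_fun_integral U' V').
Qed.

End Independence.

(** * Gaussian moments *)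

Section Gaussian.
Variable R : realType.
Local Notation mu := (@lebesgue_measure R).

Lemma ge0_integral_normal_prob (m s : R) (f : R -> \bar R) :
  measurable_fun setT f -> (forall x, 0 <= f x)%E ->
  (\int[normal_prob m s]_x f x = \int[mu]_x (f x * (normal_pdf m s x)%:E))%E.
Proof.
move=> mf f0; have dom := normal_prob_dominates m s.
rewrite -(Radon_Nikodym_SigmaFinite.change_of_variables dom f0 measurableT mf).
apply: ae_eq_integral => //.
- apply: emeasurable_funM => //; apply: (measurable_int mu).
  exact: Radon_Nikodym_SigmaFinite.f_integrable.
- apply: emeasurable_funM => //; apply/measurable_EFinP.
  exact: measurable_normal_pdf.
- apply: ae_eqe_mul2l; apply: integral_ae_eq => //=.
  + exact: Radon_Nikodym_SigmaFinite.f_integrable.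
  + by apply/measurable_EFinP; exact: measurable_normal_pdf.
  + by move=> A _ mA; rewrite -Radon_Nikodym_SigmaFinite.f_integral.
Qed.

Lemma integralZ_normal_pdf (m s c : R) : 0 <= c ->
  (\int[mu]_x (c%:E * (normal_pdf m s x)%:E) = c%:E)%E.
Proof.
move=> c0; rewrite -[RHS]mule1 -(integral_normal_pdf m s).
apply: ge0_integralZl_EFin => //.
- by move=> x _; rewrite lee_fin normal_pdf_ge0.
- by apply/measurable_EFinP; exact: measurable_normal_pdf.
Qed.

Context d (T : measurableType d) (P : probability T R) (X : {RV P >-> R}).
Hypothesis X_gauss : std_gaussian X.

Lemma gaussian_ge0_integral (f : R -> \bar R) :
  measurable_fun setT f -> (forall x, 0 <= f x)%E ->
  (\int[P]_t f (X t) = \int[mu]_x (f x * (normal_pdf 0 1 x)%:E))%E.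
Proof.
move=> mf f0; rewrite -ge0_integral_normal_prob //.
have mX : measurable_fun setT (X : T -> measurableTypeR R).
  exact: (measurable_funP X).
pose X' : {mfun T >-> measurableTypeR R} := MeasurableFun.Pack
  (MeasurableFun.Class (isMeasurableFun.Build _ _ _ _ _ mX)).
rewrite -[LHS]/(\int[P]_t (f \o X') t)%E.
rewrite -(@ge0_integral_distribution _ _ _ _ _ P X' f) //.
apply: (@eq_measure_integral _ _ _ setT (normal_prob 0 1) (distribution P X')) => A mA _.
exact: X_gauss.
Qed.

(* All moments below come from the fact that [normal_pdf m s] integrates to 1 for
   every [m] and [s], which yields the exponential moments of [X] and [X^2]. *)
Lemma gaussian_mgf (m : R) :
  (\int[P]_t (expR (m * X t))%:E = (expR (m ^+ 2 / 2))%:E)%E.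
Proof.
rewrite (gaussian_ge0_integral (f := fun x => (expR (m * x))%:E)); last 2 first.
- by apply/measurable_EFinP; apply: measurableT_comp => //; exact: measurable_funM.
- by move=> x; rewrite lee_fin expR_ge0.
rewrite -[RHS](integralZ_normal_pdf m 1 (expR_ge0 _)).
apply: eq_integral => x _; rewrite -!EFinM !normal_pdfE ?oner_eq0 //.
congr EFin; rewrite /= !mulrA ![_ * normal_peak 1]mulrC -!mulrA -!expRD.
by congr (_ * expR _); field.
Qed.

(** The exponent is chosen so that the tilted standard density is [s] times the centred normal
    density of standard deviation [s]. *)
Lemma gaussian_sqr_mgf (s : R) : 0 < s ->
  (\int[P]_t (expR ((1 - s ^- 2) / 2 * X t ^+ 2))%:E = s%:E)%E.
Proof.
move=> s0.
rewrite (gaussian_ge0_integral (f := fun x => (expR ((1 - s ^- 2) / 2 * x ^+ 2))%:E)); last 2 first.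
- apply/measurable_EFinP; apply: measurableT_comp => //.
  by apply: measurable_funM => //; exact: measurable_funX.
- by move=> x; rewrite lee_fin expR_ge0.
rewrite -[RHS](integralZ_normal_pdf 0 s (ltW s0)).
have s1 : s != 0 by rewrite gt_eqF.
apply: eq_integral => x _; rewrite -!EFinM !normal_pdfE ?oner_eq0 //.
have hs : s * normal_peak s = normal_peak 1.
  rewrite /normal_peak expr1n -!mulrnAr mul1r sqrtrM ?sqr_ge0 // sqrtr_sqr.
  by rewrite (ger0_norm (ltW s0)) invfM mulrA mulfV // mul1r.
congr EFin; rewrite mulrCA [RHS]mulrA hs -expRD; congr (_ * expR _); field.
by rewrite s1.
Qed.

Let mX : measurable_fun setT X. Proof. exact: measurable_funP. Qed.

Lemma gaussian_integrable_sqr_mgf (s : R) : 0 < s ->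
  P.-integrable setT (fun t => (expR ((1 - s ^- 2) / 2 * X t ^+ 2))%:E).
Proof.
move=> s0; apply/integrableP; split.
  apply/measurable_EFinP; apply: measurableT_comp => //.
  by apply: measurable_funM => //; exact: measurable_funX.
under eq_integral do rewrite gee0_abs ?lee_fin ?expR_ge0 //.
by rewrite gaussian_sqr_mgf // ltry.
Qed.

Lemma gaussian_integrable_mgf (m : R) :
  P.-integrable setT (fun t => (expR (m * X t))%:E).
Proof.
apply/integrableP; split.
  by apply/measurable_EFinP; apply: measurableT_comp => //; exact: measurable_funM.
under eq_integral do rewrite gee0_abs ?lee_fin ?expR_ge0 //.
by rewrite gaussian_mgf ltry.
Qed.

Lemma gaussian_integrable_even k :
  P.-integrable setT (fun t => (X t ^+ k.*2)%:E).
Proof.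
have s2 : 0 < Num.sqrt 2 :> R by rewrite sqrtr_gt0.
have := integrableZl measurableT (4 ^+ k * k`!%:R) (gaussian_integrable_sqr_mgf s2).
have p4 t : 0 <= X t ^+ k.*2 by rewrite exprn_even_ge0 // odd_double.
apply: le_integrable => //; first by apply/measurable_EFinP; exact: measurable_funX.
have c0 : 0 <= 4 ^+ k * k`!%:R :> R by rewrite mulr_ge0 ?exprn_ge0.
move=> t _; rewrite -EFinM !gee0_abs ?lee_fin ?p4 // ?(mulr_ge0 c0) ?expR_ge0 //.
(* For [s = sqrt 2] the exponent is [y = X^2 / 4], and the domination comes from
   [y^k <= k! * expR y]. *)
rewrite sqr_sqrtr //; set y := _ * X t ^+ 2.
have -> : X t ^+ k.*2 = 4 ^+ k * y ^+ k.
  by rewrite -exprMn -mul2n exprM; congr (_ ^+ _); rewrite /y; field.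
rewrite -mulrA ler_wpM2l ?exprn_ge0 //.
have y0 : 0 <= y by rewrite /y mulr_ge0 ?sqr_ge0 //; lra.
case: k {p4 c0} => [|k]; first by rewrite expr0 mul1r; have := expR_ge1Dx y; lra.
have := expR_ge1Dxn k y0; rewrite -ler_pdivrMl ?ltr0n ?fact_gt0 // mulrC; lra.
Qed.

(** A crude bound, the exact value being 3: [y^2 / 2 <= expR y] at [y = X^2 / 4], where the
    exponential has mean [sqrt 2]. *)
Lemma gaussian_fourth : (\int[P]_t (X t ^+ 4)%:E <= 64%:E)%E.
Proof.
have s2 : 0 < Num.sqrt 2 :> R by rewrite sqrtr_gt0.
have i2 := gaussian_integrable_sqr_mgf s2.
apply: (@le_trans _ _ (32 * Num.sqrt 2)%:E); last first.
  rewrite lee_fin (_ : 64 = 32 * 2) ?ler_pM2l //; last by ring.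
  by rewrite -(@ler_pXn2r _ 2) ?nnegrE ?sqrtr_ge0 // sqr_sqrtr //; lra.
rewrite EFinM -(gaussian_sqr_mgf s2) -(integralZl measurableT i2).
apply: le_integral => //.
- exact: (gaussian_integrable_even 2).
- exact: integrableZl.
move=> t _; rewrite -EFinM lee_fin sqr_sqrtr //; set y := _ * X t ^+ 2.
have -> : X t ^+ 4 = 32 * (y ^+ 2 / 2) by rewrite /y; field.
rewrite ler_pM2l //.
have y0 : 0 <= y by rewrite /y mulr_ge0 ?sqr_ge0 //; lra.
have := expR_ge1Dxn 1 y0; rewrite (_ : 2`!%:R = 2) //; lra.
Qed.

Lemma gaussian_integrable_sqr : P.-integrable setT (fun t => (X t ^+ 2)%:E).
Proof. exact: (gaussian_integrable_even 1). Qed.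

Lemma gaussian_integrable : P.-integrable setT (fun t => (X t)%:E).
Proof.
have i4 := integrableD measurableT
  (finite_measure_integrable_cst P 1 measurableT) gaussian_integrable_sqr.
apply: le_integrable i4 => //; first by apply/measurable_EFinP.
move=> t _; rewrite -EFinD [leRHS]gee0_abs ?lee_fin ?addr_ge0 ?sqr_ge0 //.
rewrite /= ler_norml; have := sqr_ge0 (X t - 1); have := sqr_ge0 (X t + 1).
by move=> h1 h2; apply/andP; split; nra.
Qed.

(** Integrating [1 + m X <= expR (m X)] gives [1 + m a <= expR (m^2 / 2)] for every real [m], with
    equality at 0. This forces the slope [a] to vanish; the contradiction is reached at [m] of the
    sign of [a] with modulus [min (|a| / 2) 1]. *)
Lemma gaussian_mean : (\int[P]_t (X t)%:E = 0)%E.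
Proof.
have fX := integrable_fin_num measurableT gaussian_integrable.
rewrite -(fineK fX); set a := fine _; congr EFin.
have h (m : R) : 1 + m * a <= expR (m ^+ 2 / 2).
  rewrite -lee_fin -gaussian_mgf EFinD EFinM fineK // -(integralZl measurableT gaussian_integrable).
  have -> : 1%:E = (\int[P]_t 1%:E)%E by rewrite integral_cst //= mul1e probability_setT.
  rewrite -integralD //; last 2 first.
  - exact: finite_measure_integrable_cst.
  - exact: integrableZl gaussian_integrable.
  apply: le_integral => //.
  - apply: integrableD => //; first exact: finite_measure_integrable_cst.
    exact: integrableZl gaussian_integrable.
  - exact: gaussian_integrable_mgf.
  - by move=> t _; rewrite -EFinM -EFinD lee_fin; exact: expR_ge1Dx.
have k (m : R) : m ^+ 2 <= 1 -> m * a <= m ^+ 2.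
  move=> m1; have := h m; have := @expR_ge1Dx _ (- (m ^+ 2 / 2)).
  rewrite expRN; have := expR_gt0 (m ^+ 2 / 2); set e := expR _ => e0 h1 h2.
  have : (1 - m ^+ 2 / 2) * e <= 1 by rewrite -ler_pdivlMr // mul1r.
  by have := sqr_ge0 m; nra.
have [a0|a0|//] := ltgtP a 0.
  have m1 : Num.min (- a / 2) 1 ^+ 2 <= 1.
    by rewrite expr_le1 // ?le_min ?ge_min ?lexx ?orbT ?ler01 ?andbT //; lra.
  have := k (- Num.min (- a / 2) 1); rewrite sqrrN => /(_ m1).
  by case: (leP (- a / 2) 1) => h1; nra.
have m1 : Num.min (a / 2) 1 ^+ 2 <= 1.
  by rewrite expr_le1 // ?le_min ?ge_min ?lexx ?orbT ?ler01 ?andbT //; lra.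
have := k _ m1.
by case: (leP (a / 2) 1) => h1; nra.
Qed.

(** The same tangency argument at [s = 1]: both sides of [1 + (1 - s^-2) / 2 * a <= s] equal 1
    there, with slopes [a] and 1. Dividing by [s - 1] of either sign gives the two inequalities. *)
Lemma gaussian_sqr : (\int[P]_t (X t ^+ 2)%:E = 1)%E.
Proof.
have fX := integrable_fin_num measurableT gaussian_integrable_sqr.
rewrite -(fineK fX); set a := fine _; congr EFin.
have h (s : R) : 0 < s -> 1 + (1 - s ^- 2) / 2 * a <= s.
  move=> s0; rewrite -lee_fin -[X in (_ <= X)%E](gaussian_sqr_mgf s0) EFinD EFinM fineK //.
  rewrite -(integralZl measurableT gaussian_integrable_sqr).
  have -> : 1%:E = (\int[P]_t 1%:E)%E by rewrite integral_cst //= mul1e probability_setT.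
  rewrite -integralD //; last 2 first.
  - exact: finite_measure_integrable_cst.
  - exact: integrableZl gaussian_integrable_sqr.
  apply: le_integral => //.
  - apply: integrableD => //; first exact: finite_measure_integrable_cst.
    exact: integrableZl gaussian_integrable_sqr.
  - exact: gaussian_integrable_sqr_mgf.
  - by move=> t _; rewrite -EFinM -EFinD lee_fin; exact: expR_ge1Dx.
have h' (s : R) : 0 < s -> (s - 1) * ((s + 1) * a) <= (s - 1) * (2 * s ^+ 2).
  move=> s0; have := h s s0; rewrite -(ler_pM2l (exprn_gt0 2 s0)).
  rewrite mulrDr mulr1 !mulrA mulrBr mulr1 divff ?gt_eqF ?exprn_gt0 //.
  by move=> h1; nra.
have up (e : R) : 0 < e -> a <= 1 + 2 * e.
  move=> e0; have /h' : 0 < 1 + e by lra.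
  rewrite [1 + e - 1]addrAC subrr add0r ler_pM2l // => h1.
  by rewrite -(@ler_pM2l _ (1 + e + 1)); nra.
have lo (e : R) : 0 < e < 1 -> 1 - 2 * e <= a.
  move=> /andP[e0 e1]; have /h' : 0 < 1 - e by lra.
  rewrite [1 - e - 1]addrAC subrr add0r ler_nM2l ?oppr_lt0 // => h1.
  by rewrite -(@ler_pM2l _ (1 - e + 1)); nra.
apply/eqP; rewrite eq_le; apply/andP; split.
  by apply/ler_addgt0Pr => e e0; have := up (e / 2); lra.
have [//|a1] := leP 1 a.
have := lo (Num.min ((1 - a) / 4) (2^-1)).
by case: (leP ((1 - a) / 4) (2^-1)) => h1; lra.
Qed.

End Gaussian.

(** * Measurability of spectral events *)

Section RationalVectors.
Variable R : realType.

Definition ratcol n (q : 'cV[rat]_n) : 'cV[R]_n := map_mx ratr q.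

Lemma ratcol_approx n (v : 'cV[R]_n) : exists q : nat -> 'cV[rat]_n,
  forall i, (fun k => ratcol (q k) i 0) @ \oo --> v i 0.
Proof.
have h (k : nat) (i : 'I_n) : exists r : rat, `|v i 0 - ratr r| <= k.+1%:R^-1.
  have k0 : 0 < k.+1%:R^-1 :> R by rewrite invr_gt0.
  have vk : v i 0 < v i 0 + k.+1%:R^-1 by rewrite ltrDl.
  have [r] := rat_in_itvoo vk.
  rewrite in_itv /= => /andP[r1 r2]; exists r.
  by rewrite ler_norml; apply/andP; split; move: r1 r2 k0; set e := k.+1%:R^-1; lra.
have [f hf] := choice (fun ki : nat * 'I_n => h ki.1 ki.2).
exists (fun k => \col_i f (k, i)) => i.
apply/cvgrPdist_lt => e e0; near=> k.
rewrite !mxE; apply: le_lt_trans (hf (k, i)) _ => /=.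
near: k; apply: near_infty_natSinv_lt (PosNum e0).
Unshelve. all: by end_near.
Qed.

Lemma cvgr_sum (I : Type) (r : seq I) (T : Type) (F : set_system T) (FF : Filter F)
    (f : I -> T -> R) (a : I -> R) :
  (forall i, f i @ F --> a i) ->
  (fun t => \sum_(i <- r) f i t) @ F --> \sum_(i <- r) a i.
Proof.
move=> fa; elim: r => [|i r IH].
  by under eq_fun do rewrite big_nil; rewrite big_nil; exact: cvg_cst.
under eq_fun do rewrite big_cons; rewrite big_cons.
by apply: cvgD => //; exact: fa.
Qed.

Lemma cvg_dot_mulmx n (M : 'M[R]_n) (u : nat -> 'cV[R]_n) (v : 'cV[R]_n) :
  (forall i, (fun k => u k i 0) @ \oo --> v i 0) ->
  (fun k => dot (u k) (M *m u k)) @ \oo --> dot v (M *m v).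
Proof.
move=> uv; under eq_fun do rewrite dot_mulmxE; rewrite dot_mulmxE.
apply: cvgr_sum => i; apply: cvgr_sum => j.
by apply: cvgM => //; apply: cvgM => //; exact: cvg_cst.
Qed.

(** Continuity of the quadratic form reduces an uncountable condition to a countable one. *)
Lemma rayleigh_le_rat n (c : R) (W : 'M[R]_n) :
  rayleigh_le c W <-> forall q : 'cV[rat]_n,
    dot (ratcol q) (W *m ratcol q) <= c * dot (ratcol q) (ratcol q).
Proof.
split => [h q|h v]; first exact: h.
have [q qv] := ratcol_approx v.
have h1 := cvg_dot_mulmx (M := W) qv.
have h2 : (fun k => c * dot (ratcol (q k)) (ratcol (q k))) @ \oo --> c * dot v v.
  have := cvg_dot_mulmx (M := 1%:M) qv; under eq_fun do rewrite mul1mx.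
  by rewrite mul1mx => h2; apply: cvgM => //; exact: cvg_cst.
apply: (ler_cvg_to h1 h2); exact: nearW.
Qed.

Section Measurable.
Context d (T : measurableType d) (n : nat) (M : T -> 'M[R]_n).
Hypothesis mM : forall i j, measurable_fun setT (fun t => M t i j).

Lemma measurable_dot_mulmx (v : 'cV[R]_n) :
  measurable_fun setT (fun t => dot v (M t *m v)).
Proof.
under eq_fun do rewrite dot_mulmxE.
apply: measurable_sum => i; apply: measurable_sum => j.
by apply: measurable_funM => //; exact: measurable_funM.
Qed.

Lemma measurable_rayleigh_le (c : R) :
  measurable [set t | rayleigh_le c (M t)].
Proof.
have -> : [set t | rayleigh_le c (M t)] = \bigcap_(q : 'cV[rat]_n)
    [set t | dot (ratcol q) (M t *m ratcol q) <= c * dot (ratcol q) (ratcol q)].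
  apply/seteqP; split => t /=.
    by move/rayleigh_le_rat => h q _; exact: h.
  by move=> h; apply/rayleigh_le_rat => q; exact: h.
rewrite -[X in measurable X]setCK setC_bigcap; apply: measurableC.
apply: countable_bigcupT_measurable => [|q]; first exact: countableP.
apply: measurableC.
have : measurable_fun setT (fun t => dot (ratcol q) (M t *m ratcol q) <=
    c * dot (ratcol q) (ratcol q)).
  by apply: measurable_fun_ler => //; exact: measurable_dot_mulmx.
by move=> /(_ measurableT [set true]); rewrite setTI; exact.
Qed.

Lemma measurable_det : measurable_fun setT (fun t => \det (M t)).
Proof.
rewrite /determinant; apply: measurable_sum => s.
apply: measurable_funM => //; apply: measurable_prod => i _.
exact: mM.
Qed.

End Measurable.

Lemma measurable_adj d (T : measurableType d) n (M : T -> 'M[R]_n) :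
  (forall i j, measurable_fun setT (fun t => M t i j)) ->
  forall i j, measurable_fun setT (fun t => \adj (M t) i j).
Proof.
move=> mM i j; under eq_fun do rewrite mxE /cofactor.
apply: measurable_funM => //; apply: measurable_det => k l.
by under eq_fun do rewrite !mxE; exact: mM.
Qed.

(** Relies on [f^-1 = f * (f^2)^-1], which brings in the measurable real power of a nonnegative
    function and holds also at zeros of [f], where both sides are 0. *)
Lemma measurable_funVr d (T : measurableType d) (f : T -> R) :
  measurable_fun setT f -> measurable_fun setT (fun t => (f t)^-1).
Proof.
move=> mf; rewrite (_ : (fun t => _) = (fun t => f t * (f t ^+ 2) `^ (-1))).
  apply: measurable_funM => //; apply: (measurableT_comp (measurable_powR (-1))).
  exact: measurable_funX.
apply/funext => t; rewrite powR_inv1 ?sqr_ge0 // expr2.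
have [->|f0] := eqVneq (f t) 0; first by rewrite invr0 mul0r.
by rewrite invfM mulrA mulfV // mul1r.
Qed.

(** On the event the matrix is invertible and its inverse is given by Cramer's rule. The measurable
    space is arbitrary, so that it can be the sigma-algebra generated by a subfamily of the
    variables. *)
Lemma measurable_resolvent d (T : measurableType d) n (M : T -> 'M[R]_n) (x eta : R) :
  0 < eta -> (forall t, (M t)^T = M t) ->
  (forall i j, measurable_fun setT (fun t => M t i j)) ->
  forall i j, measurable_fun setT (fun t =>
    if `[< rayleigh_le (x - eta) (M t) >] then invmx (x%:M - M t) i j else 0).
Proof.
move=> eta0 symM mM i j.
have mN k l : measurable_fun setT (fun t => (x%:M - M t) k l).
  by under eq_fun do rewrite !mxE; exact: measurable_funB.
rewrite (_ : (fun t => _) = (fun t =>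
    if `[< rayleigh_le (x - eta) (M t) >] then
      (\det (x%:M - M t))^-1 * \adj (x%:M - M t) i j else 0)); last first.
  apply/funext => t; case: ifPn => // /asboolP h.
  have sN : (x%:M - M t)^T = x%:M - M t by rewrite linearB /= tr_scalar_mx symM.
  by rewrite /invmx (coercive_unitmx eta0 sN (rayleigh_le_coercive h)) mxE.
apply: measurable_fun_ifT => //.
- apply: (measurable_fun_bool true); rewrite setTI.
  rewrite (_ : _ @^-1` _ = [set t | rayleigh_le (x - eta) (M t)]).
    exact: measurable_rayleigh_le.
  by apply/seteqP; split => t /= /asboolP.
- apply: measurable_funM; last exact: measurable_adj.
  apply: measurable_funVr; exact: measurable_det.
Qed.

End RationalVectors.

(** * Mean values *)

Section Moments.
Context d (T : measurableType d) (R : realType) (P : probability T R).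

(** A class stable under sums and products and contained in the integrable functions, so that
    integrability of any polynomial expression is automatic. Even powers dispense with absolute
    values. *)
Definition even_moments (f : T -> R) := measurable_fun setT f /\
  forall k, P.-integrable setT (fun t => (f t ^+ k.*2)%:E).

Definition mean (f : T -> R) : R := fine (\int[P]_t (f t)%:E)%E.

Lemma even_moments_bounded (f : T -> R) C : measurable_fun setT f ->
  (forall t, `|f t| <= C) -> even_moments f.
Proof.
move=> mf fC; split => // k.
apply: le_integrable (finite_measure_integrable_cst P (C ^+ k.*2) measurableT) => //.
  by apply/measurable_EFinP; exact: measurable_funX.
move=> t _; rewrite /= lee_fin normrX [leRHS]ger0_norm; last first.
  by rewrite exprn_even_ge0 // odd_double.
apply: lerXn2r; rewrite ?nnegrE //; exact: le_trans (fC t).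
Qed.

Lemma even_moments_cst c : even_moments (fun=> c).
Proof. by apply: (@even_moments_bounded _ `|c|) => //; exact: measurable_cst. Qed.

Lemma even_momentsM (f g : T -> R) :
  even_moments f -> even_moments g -> even_moments (fun t => f t * g t).
Proof.
move=> [mf hf] [mg hg]; split; first exact: measurable_funM.
move=> k; have := integrableD measurableT (hf k.*2) (hg k.*2).
apply: le_integrable => //.
  by apply/measurable_EFinP; apply: measurable_funX; exact: measurable_funM.
move=> t _; rewrite -EFinD lee_fin exprMn.
rewrite -(muln2 k.*2) !exprM; set a := f t ^+ _; set b := g t ^+ _.
rewrite [leRHS]ger0_norm ?addr_ge0 ?sqr_ge0 // ler_norml; apply/andP; split.
  by have := sqr_ge0 (a + b); have := sqr_ge0 a; have := sqr_ge0 b; nra.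
by have := sqr_ge0 (a - b); have := sqr_ge0 a; have := sqr_ge0 b; nra.
Qed.

Lemma even_momentsD (f g : T -> R) :
  even_moments f -> even_moments g -> even_moments (fun t => f t + g t).
Proof.
move=> [mf hf] [mg hg]; split; first exact: measurable_funD.
move=> k.
have := integrableZl measurableT (2 ^+ k.*2) (integrableD measurableT (hf k) (hg k)).
apply: le_integrable => //.
  by apply/measurable_EFinP; apply: measurable_funX; exact: measurable_funD.
have p (x : R) : 0 <= x ^+ k.*2 by rewrite exprn_even_ge0 // odd_double.
have q (x : R) : x ^+ k.*2 = `|x| ^+ k.*2.
  by rewrite -mul2n !exprM real_normK ?num_real.
move=> t _; rewrite -EFinD -EFinM lee_fin !ger0_norm ?mulr_ge0 ?addr_ge0 ?p //.
apply: (@le_trans _ _ ((2 * Num.max `|f t| `|g t|) ^+ k.*2)).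
  rewrite q; apply: lerXn2r; rewrite ?nnegrE ?mulr_ge0 ?le_max ?normr_ge0 //.
  apply: le_trans (ler_normD _ _) _; rewrite mulrC mulrDr mulr1.
  by rewrite lerD // le_max lexx ?orbT.
rewrite exprMn ler_wpM2l ?exprn_ge0 //.
by case: (leP `|f t| `|g t|) => _; rewrite -q ?lerDl ?lerDr p.
Qed.

Lemma even_moments_sum (I : Type) (r : seq I) (Q : pred I) (f : I -> T -> R) :
  (forall i, Q i -> even_moments (f i)) ->
  even_moments (fun t => \sum_(i <- r | Q i) f i t).
Proof.
move=> hf; elim: r => [|i r IH].
  by under eq_fun do rewrite big_nil; exact: even_moments_cst.
have [Qi|Qi] := boolP (Q i); last by under eq_fun do rewrite big_cons (negbTE Qi).
under eq_fun do rewrite big_cons Qi.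
by apply: even_momentsD => //; exact: hf.
Qed.

Lemma even_moments_integrable (f : T -> R) : even_moments f ->
  P.-integrable setT (fun t => (f t)%:E).
Proof.
move=> [mf hf].
have := integrableD measurableT (finite_measure_integrable_cst P 1 measurableT) (hf 1%N).
apply: le_integrable => //; first by apply/measurable_EFinP.
move=> t _; rewrite -EFinD lee_fin [leRHS]ger0_norm ?addr_ge0 ?sqr_ge0 //.
rewrite /= ler_norml; apply/andP; split.
  by have := sqr_ge0 (f t + 1); nra.
by have := sqr_ge0 (f t - 1); nra.
Qed.

Lemma meanE (f : T -> R) : even_moments f ->
  (\int[P]_t (f t)%:E = (mean f)%:E)%E.
Proof.
by move=> /even_moments_integrable hf; rewrite /mean fineK // integrable_fin_num.
Qed.

Lemma mean_cst c : mean (fun=> c) = c.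
Proof. by rewrite /mean integral_cst //= probability_setT mule1. Qed.

Lemma meanD (f g : T -> R) : even_moments f -> even_moments g ->
  mean (fun t => f t + g t) = mean f + mean g.
Proof.
move=> hf hg; apply: EFin_inj; rewrite EFinD -!meanE //; last exact: even_momentsD.
under eq_integral do rewrite EFinD.
by rewrite integralD //; exact: even_moments_integrable.
Qed.

Lemma meanZ c (f : T -> R) : even_moments f ->
  mean (fun t => c * f t) = c * mean f.
Proof.
move=> hf; apply: EFin_inj; rewrite EFinM -!meanE //; last first.
  by apply: even_momentsM => //; exact: even_moments_cst.
under eq_integral do rewrite EFinM.
by rewrite integralZl //; exact: even_moments_integrable.
Qed.

Lemma mean_sum (I : Type) (r : seq I) (Q : pred I) (f : I -> T -> R) :
  (forall i, Q i -> even_moments (f i)) ->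
  mean (fun t => \sum_(i <- r | Q i) f i t) = \sum_(i <- r | Q i) mean (f i).
Proof.
move=> hf; elim: r => [|i r IH].
  by under eq_fun do rewrite big_nil; rewrite big_nil mean_cst.
rewrite big_cons; have [Qi|Qi] := boolP (Q i); last first.
  by under eq_fun do rewrite big_cons (negbTE Qi).
under eq_fun do rewrite big_cons Qi.
by rewrite meanD ?IH //; [exact: hf|exact: even_moments_sum].
Qed.

Lemma le_mean (f g : T -> R) : even_moments f -> even_moments g ->
  (forall t, f t <= g t) -> mean f <= mean g.
Proof.
move=> hf hg fg; rewrite -lee_fin -!meanE //.
apply: le_integral => //; try exact: even_moments_integrable.
by move=> t _; rewrite lee_fin.
Qed.

Lemma mean_ge0 (f : T -> R) : (forall t, 0 <= f t) -> 0 <= mean f.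
Proof. by move=> f0; apply: fine_ge0; apply: integral_ge0 => t _; rewrite lee_fin. Qed.

Lemma mean_markov (f : T -> R) (A : set T) c : 0 < c -> even_moments f ->
  (forall t, 0 <= f t) -> measurable A -> (forall t, A t -> c <= f t) ->
  (P A <= (c^-1 * mean f)%:E)%E.
Proof.
move=> c0 hf f0 mA Af.
have h : (\int[P]_t (c%:E * (\1_A t)%:E) <= \int[P]_t (f t)%:E)%E.
  apply: ge0_le_integral => //.
  - by move=> t _; rewrite -EFinM lee_fin mulr_ge0 // ltW.
  - by apply: measurable_funeM; apply/measurable_EFinP; exact: measurable_indic.
  - by apply/measurable_EFinP; case: hf.
  move=> t _; rewrite -EFinM lee_fin indicE.
  by case: (boolP (t \in A)) => [/set_mem /Af|_]; rewrite ?mulr1 ?mulr0.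
have e : (\int[P]_t (c%:E * (\1_A t)%:E) = c%:E * P A)%E.
  rewrite ge0_integralZl_EFin ?(ltW c0) //.
    by rewrite integral_indic // setIT.
  by apply/measurable_EFinP; exact: measurable_indic.
move: h; rewrite e meanE // -(fineK (fin_num_measure P A mA)) -EFinM !lee_fin.
by rewrite mulrC -ler_pdivlMr // mulrC.
Qed.

Variables (I : finType) (X : I -> {RV P >-> R}).
Hypothesis X_indep : mutually_independent X.

Lemma mean_indep (J K : {set I}) (U V : T -> R) :
  (forall i, i \in J -> i \notin K) ->
  sigma_measurable X J U -> sigma_measurable X K V ->
  even_moments U -> even_moments V ->
  mean (fun t => U t * V t) = mean U * mean V.
Proof.
move=> JK sU sV hU hV; apply: EFin_inj.
rewrite EFinM -!meanE //; last exact: even_momentsM.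
by have [] := sigma_measurable_integral X_indep JK sU sV
  (even_moments_integrable hU) (even_moments_integrable hV).
Qed.

End Moments.

(** * The top of the spectrum of a Wigner matrix *)

(** The zero diagonal reflects the sum over [i < j] in [TAP], and it makes the Schur complement of a
    row exactly [x - q]. *)
Definition wigner (R : realType) n (g : 'M[R]_n) : 'M[R]_n :=
  \matrix_(i, j) if i == j then 0 else (Num.sqrt n%:R)^-1 * gbar g i j.

Lemma wigner_sym (R : realType) n (g : 'M[R]_n) : (wigner g)^T = wigner g.
Proof.
by apply/matrixP => i j; rewrite !mxE eq_sym /gbar [g j i + _]addrC.
Qed.

Section WignerRow.
Context d (T : measurableType d) (R : realType) (P : probability T R).
Variables (n : nat) (X : 'I_n -> 'I_n -> {RV P >-> R}).
Hypothesis X_iid : iid_std_gaussian X.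
Variables (x eta : R).
Hypothesis eta_gt0 : 0 < eta.

Let Y (ij : 'I_n * 'I_n) : {RV P >-> R} := X ij.1 ij.2.
Let Y_indep : mutually_independent Y := X_iid.1.
Let X_gauss i j : std_gaussian (X i j) := X_iid.2 i j.
Let g t : 'M[R]_n := \matrix_(i, j) X i j t.
Let W t := wigner (g t).
Let em := even_moments P.
Let E := mean P.

Let X_em i j : em (X i j).
Proof.
split; first exact: measurable_funP.
by move=> k; exact: gaussian_integrable_even.
Qed.

Variable i : 'I_n.
Let n_gt0 : (0 < n)%N. Proof. exact: leq_ltn_trans (ltn_ord i). Qed.
Let n0 : 0 < n%:R :> R. Proof. by rewrite ltr0n. Qed.

Let w (j : 'I_n) (t : T) : R := W t i j.

Let wE j t : i != j ->
  w j t = ((Num.sqrt n%:R)^-1 * (Num.sqrt 2)^-1) * (X i j t + X j i t).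
Proof. by move=> ij; rewrite /w /W !mxE (negbTE ij) /gbar !mxE mulrA. Qed.

Let w_funE j : i != j -> w j = fun t =>
  ((Num.sqrt n%:R)^-1 * (Num.sqrt 2)^-1) * (X i j t + X j i t).
Proof. by move=> ij; apply/funext => t; exact: wE. Qed.

Let ccE : ((Num.sqrt n%:R)^-1 * (Num.sqrt 2)^-1) ^+ 2 = (2 * n%:R)^-1 :> R.
Proof.
by rewrite exprMn !exprVn !sqr_sqrtr ?ler0n // [RHS]invfM mulrC.
Qed.

Let w_em j : i != j -> em (w j).
Proof.
move=> ij; rewrite (w_funE ij); apply: even_momentsM; first exact: even_moments_cst.
by apply: even_momentsD; exact: X_em.
Qed.

Let w_sigma j (J : {set 'I_n * 'I_n}) : i != j -> (i, j) \in J -> (j, i) \in J ->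
  sigma_measurable Y J (w j).
Proof.
move=> ij h1 h2; rewrite (w_funE ij); apply: measurable_funM => //.
apply: measurable_funD.
- exact: (@sigma_measurable_coord _ _ _ _ _ Y J (i, j)).
- exact: (@sigma_measurable_coord _ _ _ _ _ Y J (j, i)).
Qed.

Let X_mean a b : E (X a b) = 0.
Proof. by rewrite /E /mean gaussian_mean. Qed.

Let X_sqr a b : E (fun t => X a b t ^+ 2) = 1.
Proof. by rewrite /E /mean gaussian_sqr. Qed.

Let w_mean j : i != j -> E (w j) = 0.
Proof.
move=> ij; rewrite (w_funE ij) /E meanZ; last by apply: even_momentsD; exact: X_em.
rewrite meanD; try exact: X_em.
by rewrite -/E !X_mean addr0 mulr0.
Qed.

Let w_sqr j : i != j -> E (fun t => w j t ^+ 2) = n%:R^-1.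
Proof.
move=> ij; have xs a b : em (fun t => X a b t * X a b t) by apply: even_momentsM; exact: X_em.
have xy : em (fun t => X i j t * X j i t) by apply: even_momentsM; exact: X_em.
have -> : (fun t => w j t ^+ 2) = (fun t => (2 * n%:R)^-1 *
    ((X i j t * X i j t + X j i t * X j i t) + 2 * (X i j t * X j i t))).
  apply/funext => t; rewrite wE // exprMn ccE; ring.
have xy2 : em (fun t => 2 * (X i j t * X j i t)).
  by apply: even_momentsM => //; exact: even_moments_cst.
have xx : em (fun t => X i j t * X i j t + X j i t * X j i t).
  exact: even_momentsD (xs i j) (xs j i).
have xxy : em (fun t => X i j t * X i j t + X j i t * X j i t + 2 * (X i j t * X j i t)).
  exact: even_momentsD xx xy2.
have s0 : E (fun t => X i j t * X j i t) = 0.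
  rewrite /E (mean_indep Y_indep (J := [set (i, j)]%SET) (K := [set (j, i)]%SET)).
  - by rewrite -/E X_mean mul0r.
  - by move=> a; rewrite !inE => /eqP ->; rewrite xpair_eqE negb_and ij.
  - by apply: (@sigma_measurable_coord _ _ _ _ _ Y _ (i, j)); rewrite inE.
  - by apply: (@sigma_measurable_coord _ _ _ _ _ Y _ (j, i)); rewrite inE.
  - exact: X_em.
  - exact: X_em.
rewrite /E (meanZ _ xxy) (meanD xx xy2) (meanD (xs i j) (xs j i)) (meanZ _ xy) -/E s0.
rewrite mulr0 addr0.
have sq a b : E (fun t => X a b t * X a b t) = 1.
  by rewrite -[RHS](X_sqr a b); congr E; apply/funext => t; rewrite expr2.
by rewrite !sq; field; rewrite gt_eqF.
Qed.

Let w_fourth j : i != j -> E (fun t => w j t ^+ 4) <= 256 / n%:R ^+ 2.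
Proof.
move=> ij; have x4 a b : em (fun t => X a b t ^+ 4).
  have -> : (fun t => X a b t ^+ 4) = fun t => X a b t * X a b t * (X a b t * X a b t).
    by apply/funext => t; ring.
  by apply: even_momentsM; apply: even_momentsM; exact: X_em.
have x44 := even_momentsD (x4 i j) (x4 j i).
have E4 a b : E (fun t => X a b t ^+ 4) <= 64.
  by rewrite -lee_fin -(meanE (x4 a b)); exact: gaussian_fourth.
apply: (@le_trans _ _ (E (fun t => (2 / n%:R ^+ 2) * (X i j t ^+ 4 + X j i t ^+ 4)))).
  apply: le_mean.
  - have -> : (fun t => w j t ^+ 4) = fun t => w j t * w j t * (w j t * w j t).
      by apply/funext => t; ring.
    by apply: even_momentsM; apply: even_momentsM; exact: w_em.
  - by apply: even_momentsM => //; exact: even_moments_cst.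
  move=> t; rewrite wE // exprMn (exprM _ 2 2) ccE.
  have -> : (2 * n%:R)^-1 ^+ 2 = (4 * n%:R ^+ 2)^-1 :> R by field; rewrite gt_eqF.
  set a := X i j t; set b := X j i t.
  have -> : 2 / n%:R ^+ 2 * (a ^+ 4 + b ^+ 4) =
     (4 * n%:R ^+ 2)^-1 * (8 * (a ^+ 4 + b ^+ 4)) :> R by field; rewrite gt_eqF.
  rewrite ler_wpM2l ?invr_ge0 ?mulr_ge0 ?sqr_ge0 //.
  have h1 : (a + b) ^+ 2 <= 2 * (a ^+ 2 + b ^+ 2) by have := sqr_ge0 (a - b); nra.
  have h2 : (a + b) ^+ 2 ^+ 2 <= (2 * (a ^+ 2 + b ^+ 2)) ^+ 2.
    by apply: lerXn2r => //; rewrite nnegrE ?sqr_ge0 // mulr_ge0 // addr_ge0 ?sqr_ge0.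
  have h3 := sqr_ge0 (a ^+ 2 - b ^+ 2).
  by rewrite (exprM _ 2 2); nra.
rewrite /E (meanZ _ x44) (meanD (x4 i j) (x4 j i)) -/E.
have := E4 i j; have := E4 j i; move: (E _) (E _) => u v hu hv.
have -> : 256 / n%:R ^+ 2 = 2 / n%:R ^+ 2 * (64 + 64) :> R by field; rewrite gt_eqF.
by rewrite ler_wpM2l ?divr_ge0 ?sqr_ge0 // lerD.
Qed.

(* The cut-off depends, like the resolvent itself, only on the variables
   outside row and column [i]. *)
Let F (j k : 'I_n) (t : T) : R :=
  if `[< rayleigh_le (x - eta) (rcdel i (W t)) >]
  then invmx (x%:M - rcdel i (W t)) j k else 0.

Let Wi_sym t : (rcdel i (W t))^T = rcdel i (W t).
Proof. by apply: rcdel_sym; exact: wigner_sym. Qed.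

Let F_sigma j k (J : {set 'I_n * 'I_n}) :
  (forall a b, a != i -> b != i -> (a, b) \in J) -> sigma_measurable Y J (F j k).
Proof.
move=> hJ; apply: measurable_resolvent => // a b.
under eq_fun do rewrite !mxE.
case: (altP (a =P i)) => [_|ai] /=; first exact: measurable_cst.
case: (altP (b =P i)) => [_|bi] /=; first exact: measurable_cst.
case: (altP (a =P b)) => [_|ab] /=; first exact: measurable_cst.
rewrite /gbar; under eq_fun do rewrite !mxE.
apply: measurable_funM => //; apply: measurable_funM => //.
apply: measurable_funD.
- by apply: (@sigma_measurable_coord _ _ _ _ _ Y J (a, b)); exact: hJ.
- by apply: (@sigma_measurable_coord _ _ _ _ _ Y J (b, a)); exact: hJ.
Qed.

Let F_le j k t : F j k t ^+ 2 <= eta^-1 ^+ 2.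
Proof.
rewrite /F; case: ifPn => [/asboolP h|_]; last by rewrite expr0n exprn_even_ge0.
by apply: coercive_inv_sqr => //; [rewrite linearB /= tr_scalar_mx Wi_sym|
  exact: rayleigh_le_coercive h].
Qed.

Let F_sum t : \sum_j \sum_k F j k t ^+ 2 <= n%:R * eta^-1 ^+ 2.
Proof.
rewrite /F; case: (asboolP (rayleigh_le (x - eta) (rcdel i (W t)))) => h; last first.
  rewrite big1; first by apply: mulr_ge0; [exact: ler0n|exact: sqr_ge0].
  move=> j _; rewrite big1 // => k _.
  by rewrite expr0n.
by apply: coercive_inv_sum_sqr => //; [rewrite linearB /= tr_scalar_mx Wi_sym|
  exact: rayleigh_le_coercive h].
Qed.

Let F_symm j k t : F j k t = F k j t.
Proof.
rewrite /F; case: ifPn => // /asboolP h.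
have : (invmx (x%:M - rcdel i (W t)))^T = invmx (x%:M - rcdel i (W t)).
  by apply: coercive_inv_sym; rewrite linearB /= tr_scalar_mx Wi_sym.
by move=> /matrixP /(_ k j); rewrite mxE.
Qed.

Let F_em j k : em (F j k).
Proof.
apply: (@even_moments_bounded _ _ _ _ _ eta^-1).
  by apply: (@sigma_measurableT _ _ _ _ _ Y [set: 'I_n * 'I_n]%SET);
    apply: F_sigma => a b; rewrite inE.
move=> t; rewrite -(@ler_pXn2r _ 2) ?nnegrE ?invr_ge0 ?(ltW eta_gt0) //.
by rewrite real_normK ?num_real.
Qed.

Let xi (j k : 'I_n) (t : T) : R := w j t * w k t - (j == k)%:R / n%:R.

Let xi_em j k : i != j -> i != k -> em (xi j k).
Proof.
move=> ij ik; rewrite /xi; apply: even_momentsD; last exact: even_moments_cst.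
by apply: even_momentsM; exact: w_em.
Qed.

(** The two variables behind the entry [w a]; for [a != i], the resolvent of the minor and the other
    entries of the row depend only on the complement. *)
Let L (a : 'I_n) : {set 'I_n * 'I_n} := [set (i, a); (a, i)]%SET.

Let vanish a (U V : T -> R) : i != a ->
  sigma_measurable Y (L a) U -> sigma_measurable Y (~: L a)%SET V ->
  em U -> em V -> E U = 0 -> E (fun t => U t * V t) = 0.
Proof.
move=> ia sU sV hU hV U0; rewrite /E (mean_indep Y_indep (J := L a) (K := (~: L a)%SET)) //.
  by rewrite -/E U0 mul0r.
by move=> b hb; rewrite finset.in_setC negbK.
Qed.

Let FF_sigma a j k l m : sigma_measurable Y (~: L a)%SET (fun t => F j k t * F l m t).
Proof.
by apply: measurable_funM; apply: F_sigma => b c bi ci;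
  rewrite !inE !xpair_eqE (negbTE bi) (negbTE ci) andbF.
Qed.

Let w_sigmaC a j : i != a -> i != j -> j != a -> sigma_measurable Y (~: L a)%SET (w j).
Proof.
move=> ia ij ja; apply: w_sigma => //; rewrite !inE !xpair_eqE (negbTE ja) (negbTE ia) ?andbF //=.
Qed.

Let xi_sigma j k (J : {set 'I_n * 'I_n}) : sigma_measurable Y J (w j) ->
  sigma_measurable Y J (w k) -> sigma_measurable Y J (xi j k).
Proof. by move=> hj hk; apply: measurable_funB => //; exact: measurable_funM. Qed.

Let w_sigmaL a : i != a -> sigma_measurable Y (L a) (w a).
Proof. by move=> ia; apply: w_sigma => //; rewrite !inE eqxx ?orbT. Qed.

Let xi_diag_mean j : i != j -> E (xi j j) = 0.
Proof.
move=> ij; have ww : em (fun t => w j t * w j t) by apply: even_momentsM; exact: w_em.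
rewrite /xi eqxx /E (meanD ww) ?mean_cst; last exact: even_moments_cst.
rewrite -/E (_ : (fun t => w j t * w j t) = fun t => w j t ^+ 2) ?w_sqr //.
by rewrite mul1r subrr.
Qed.

Let vanish2 a j k l m (U S : T -> R) : i != a ->
  sigma_measurable Y (L a) U -> em U -> E U = 0 ->
  sigma_measurable Y (~: L a)%SET S -> em S ->
  E (fun t => F j k t * F l m t * (U t * S t)) = 0.
Proof.
move=> ia sU hU U0 sS hS.
have -> : (fun t => F j k t * F l m t * (U t * S t)) =
    fun t => U t * (F j k t * F l m t * S t).
  by apply/funext => t; ring.
apply: (vanish ia sU _ hU _ U0).
- by apply: measurable_funM => //; exact: FF_sigma.
- by apply: even_momentsM => //; apply: even_momentsM; exact: F_em.
Qed.

Let xi_offdiag j k : j != k -> xi j k = fun t => w j t * w k t.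
Proof. by move=> jk; apply/funext => t; rewrite /xi (negbTE jk) mul0r subr0. Qed.

(** Unless the unordered pairs of indices coincide, some index [a] enters the product of the [xi]
    only through a centred factor, [w a] or [xi a a], which is independent of everything else. The
    case distinction locates this index. *)
Let cross j k l m : i != j -> i != k -> i != l -> i != m ->
  (l, m) != (j, k) -> (l, m) != (k, j) ->
  E (fun t => F j k t * F l m t * (xi j k t * xi l m t)) = 0.
Proof.
move=> ij ik il im; rewrite !xpair_eqE !negb_and => h1 h2.
have [ejk|jk] := eqVneq j k.
  subst k; have [elm|lm] := eqVneq l m.
    subst m; rewrite orbb in h1.
    apply: (vanish2 _ _ _ _ ij) => //.
    - by apply: xi_sigma; exact: w_sigmaL.
    - exact: xi_em.
    - exact: xi_diag_mean.
    - by apply: xi_sigma; exact: w_sigmaC.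
    - exact: xi_em.
  rewrite (xi_offdiag lm); have [elj|lj] := eqVneq l j.
    subst l; rewrite eq_sym in lm.
    have -> : (fun t => F j j t * F j m t * (xi j j t * (w j t * w m t))) =
        fun t => F j j t * F j m t * (w m t * (xi j j t * w j t)).
      by apply/funext => t; ring.
    apply: (vanish2 _ _ _ _ im); rewrite ?w_mean //.
    - exact: w_sigmaL.
    - exact: w_em.
    - apply: measurable_funM; last by apply: w_sigmaC => //; rewrite eq_sym.
      by apply: xi_sigma; apply: w_sigmaC => //; rewrite eq_sym.
    - by apply: even_momentsM; [exact: xi_em|exact: w_em].
  have -> : (fun t => F j j t * F l m t * (xi j j t * (w l t * w m t))) =
      fun t => F j j t * F l m t * (w l t * (xi j j t * w m t)).
    by apply/funext => t; ring.
  apply: (vanish2 _ _ _ _ il); rewrite ?w_mean //.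
  - exact: w_sigmaL.
  - exact: w_em.
  - apply: measurable_funM; last by apply: w_sigmaC => //; rewrite eq_sym.
    by apply: xi_sigma; apply: w_sigmaC => //; rewrite eq_sym.
  - by apply: even_momentsM; [exact: xi_em|exact: w_em].
rewrite (xi_offdiag jk).
have [elm|lm] := eqVneq l m.
  subst m; have [ejl|jl] := eqVneq j l.
    subst l.
    have -> : (fun t => F j k t * F j j t * (w j t * w k t * xi j j t)) =
        fun t => F j k t * F j j t * (w k t * (w j t * xi j j t)).
      by apply/funext => t; ring.
    apply: (vanish2 _ _ _ _ ik); rewrite ?w_mean //.
    - exact: w_sigmaL.
    - exact: w_em.
    - apply: measurable_funM; first exact: w_sigmaC.
      by apply: xi_sigma; exact: w_sigmaC.
    - by apply: even_momentsM; [exact: w_em|exact: xi_em].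
  have -> : (fun t => F j k t * F l l t * (w j t * w k t * xi l l t)) =
      fun t => F j k t * F l l t * (w j t * (w k t * xi l l t)).
    by apply/funext => t; ring.
  apply: (vanish2 _ _ _ _ ij); rewrite ?w_mean //.
  - exact: w_sigmaL.
  - exact: w_em.
  - apply: measurable_funM; first by apply: w_sigmaC => //; rewrite eq_sym.
    by apply: xi_sigma; apply: w_sigmaC => //; rewrite eq_sym.
  - by apply: even_momentsM; [exact: w_em|exact: xi_em].
rewrite (xi_offdiag lm).
have wlm : em (fun t => w l t * w m t) by apply: even_momentsM; exact: w_em.
have [/andP[lj mj]|hj] := boolP ((l != j) && (m != j)).
  have -> : (fun t => F j k t * F l m t * (w j t * w k t * (w l t * w m t))) =
      fun t => F j k t * F l m t * (w j t * (w k t * (w l t * w m t))).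
    by apply/funext => t; ring.
  apply: (vanish2 _ _ _ _ ij); rewrite ?w_mean //.
  - exact: w_sigmaL.
  - exact: w_em.
  - apply: measurable_funM; first by apply: w_sigmaC => //; rewrite eq_sym.
    by apply: measurable_funM; exact: w_sigmaC.
  - by apply: even_momentsM => //; exact: w_em.
(* One of [l], [m] equals [j]; as the two pairs differ, [k] is then the isolated index. *)
have [lk mk] : l != k /\ m != k.
  move: hj; rewrite negb_and !negbK => /orP[] /eqP e; subst j; split => //.
  - by move: h1; rewrite eqxx.
  - by move: h2; rewrite eqxx orbF.
have -> : (fun t => F j k t * F l m t * (w j t * w k t * (w l t * w m t))) =
    fun t => F j k t * F l m t * (w k t * (w j t * (w l t * w m t))).
  by apply/funext => t; ring.
apply: (vanish2 _ _ _ _ ik); rewrite ?w_mean //.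
- exact: w_sigmaL.
- exact: w_em.
- apply: measurable_funM; first exact: w_sigmaC.
  by apply: measurable_funM; exact: w_sigmaC.
- by apply: even_momentsM => //; exact: w_em.
Qed.

Let xi_sqr j k : i != j -> i != k ->
  E (fun t => xi j k t ^+ 2) <= 256 / n%:R ^+ 2.
Proof.
move=> ij ik; have [ejk|jk] := eqVneq j k.
  subst k; apply: le_trans (w_fourth ij).
  have w2 : em (fun t => w j t ^+ 2).
    have -> : (fun t => w j t ^+ 2) = fun t => w j t * w j t.
      by apply/funext => t; rewrite expr2.
    by apply: even_momentsM; exact: w_em.
  have w4 : em (fun t => w j t ^+ 4).
    have -> : (fun t => w j t ^+ 4) = fun t => w j t ^+ 2 * w j t ^+ 2.
      by apply/funext => t; ring.
    exact: even_momentsM.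
  have e1 : (fun t => xi j j t ^+ 2) = fun t =>
      w j t ^+ 4 + ((- (2 / n%:R)) * w j t ^+ 2 + n%:R^-1 ^+ 2).
    by apply/funext => t; rewrite /xi eqxx mul1r; field; rewrite gt_eqF.
  have h1 : em (fun t => - (2 / n%:R) * w j t ^+ 2).
    by apply: even_momentsM => //; exact: even_moments_cst.
  have h2 : em (fun t => n%:R^-1 ^+ 2) by exact: even_moments_cst.
  rewrite e1 /E (meanD w4 (even_momentsD h1 h2)) (meanD h1 h2) (meanZ _ w2).
  rewrite mean_cst -/E w_sqr // gerDl.
  have -> : - (2 / n%:R) / n%:R + n%:R^-1 ^+ 2 = - (n%:R^-1 ^+ 2) :> R.
    by field; rewrite gt_eqF.
  by rewrite oppr_le0 sqr_ge0.
have -> : (fun t => xi j k t ^+ 2) = fun t => (w j t * w j t) * (w k t * w k t).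
  by apply/funext => t; rewrite xi_offdiag //; ring.
have sq a : i != a -> E (fun t => w a t * w a t) = n%:R^-1.
  by move=> ia; rewrite -(w_sqr ia); congr E; apply/funext => t; rewrite expr2.
rewrite /E (mean_indep Y_indep (J := L j) (K := (~: L j)%SET)).
- rewrite -/E !sq //.
  have -> : 256 / n%:R ^+ 2 = 256 * (n%:R^-1 * n%:R^-1) :> R.
    by field; rewrite gt_eqF.
  by rewrite ler_peMl ?mulr_ge0 ?invr_ge0 ?ler0n // ler1n.
- by move=> b hb; rewrite finset.in_setC negbK.
- by apply: measurable_funM; exact: w_sigmaL.
- by apply: measurable_funM; apply: w_sigmaC => //; rewrite eq_sym.
- by apply: even_momentsM; exact: w_em.
- by apply: even_momentsM; exact: w_em.
Qed.

Let diag j k : i != j -> i != k ->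
  E (fun t => (F j k t * xi j k t) ^+ 2) <= 256 / n%:R ^+ 2 * E (fun t => F j k t ^+ 2).
Proof.
move=> ij ik.
have -> : (fun t => (F j k t * xi j k t) ^+ 2) =
    fun t => (F j k t * F j k t) * (xi j k t * xi j k t).
  by apply/funext => t; ring.
pose J : {set 'I_n * 'I_n} := [set ab | (ab.1 != i) && (ab.2 != i)]%SET.
have wJ a : i != a -> sigma_measurable Y (~: J)%SET (w a).
  by move=> ia; apply: w_sigma => //; rewrite !inE eqxx ?andbF.
have FJ : sigma_measurable Y J (F j k).
  by apply: F_sigma => a b ai bi; rewrite inE ai bi.
rewrite /E (mean_indep Y_indep (J := J) (K := (~: J)%SET)).
- have -> : (fun t => F j k t * F j k t) = fun t => F j k t ^+ 2.
    by apply/funext => t; rewrite expr2.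
  have -> : (fun t => xi j k t * xi j k t) = fun t => xi j k t ^+ 2.
    by apply/funext => t; rewrite expr2.
  rewrite mulrC ler_wpM2r ?xi_sqr // mean_ge0 // => t; exact: sqr_ge0.
- by move=> b hb; rewrite finset.in_setC negbK.
- exact: measurable_funM.
- by apply: measurable_funM; apply: xi_sigma; exact: wJ.
- by apply: even_momentsM; exact: F_em.
- by apply: even_momentsM; exact: xi_em.
Qed.

(** Coincides with [schur_fluct] where the cut-off is inactive, and has controlled moments on the
    whole space. *)
Definition cut_fluct (t : T) : R :=
  \sum_(p | (p.1 != i) && (p.2 != i)) F p.1 p.2 t * xi p.1 p.2 t.

Lemma cut_fluctE t : rayleigh_le (x - eta) (rcdel i (W t)) ->
  cut_fluct t = schur_fluct x i (W t).
Proof.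
move=> h; rewrite /cut_fluct /schur_fluct pair_big_dep /=.
by apply: eq_bigr => p _; rewrite /F asboolT.
Qed.

Let Fxi_em (p : 'I_n * 'I_n) : (p.1 != i) && (p.2 != i) ->
  em (fun t => F p.1 p.2 t * xi p.1 p.2 t).
Proof.
move=> /andP[p1 p2]; apply: even_momentsM; first exact: F_em.
by apply: xi_em; rewrite eq_sym.
Qed.

Lemma cut_fluct_even_moments : even_moments P cut_fluct.
Proof. exact: even_moments_sum. Qed.

(** By orthogonality the square costs only [256 / n^2] times twice the sum of the squared resolvent
    entries. That sum is of order [n], not [n^2], because each column of the resolvent has bounded
    norm. *)
Lemma mean_cut_fluct_sqr :
  mean P (fun t => cut_fluct t ^+ 2) <= 512 * eta^-1 ^+ 2 / n%:R.
Proof.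
pose Q (p : 'I_n * 'I_n) := (p.1 != i) && (p.2 != i).
pose G (p : 'I_n * 'I_n) t := F p.1 p.2 t * xi p.1 p.2 t.
have GG p q : Q p -> Q q -> em (fun t => G p t * G q t).
  by move=> Qp Qq; apply: even_momentsM; exact: Fxi_em.
have -> : (fun t => cut_fluct t ^+ 2) =
    fun t => \sum_(p | Q p) \sum_(q | Q q) G p t * G q t.
  apply/funext => t; rewrite expr2 /cut_fluct mulr_suml.
  by apply: eq_bigr => p _; rewrite mulr_sumr.
rewrite mean_sum => [|p Qp]; last by apply: even_moments_sum => q Qq; exact: GG.
pose sw (p : 'I_n * 'I_n) := (p.2, p.1).
have step p : Q p -> mean P (fun t => \sum_(q | Q q) G p t * G q t) <=
    512 / n%:R ^+ 2 * E (fun t => F p.1 p.2 t ^+ 2).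
  move=> Qp; have /andP[p1 p2] := Qp; rewrite ![_ == i]eq_sym in p1 p2.
  rewrite mean_sum => [|q Qq]; last exact: GG.
  set c := E (fun t => G p t ^+ 2).
  have c0 : 0 <= c by apply: mean_ge0 => t; exact: sqr_ge0.
  have Gsq : E (fun t => G p t * G p t) = c.
    by congr E; apply/funext => t; rewrite expr2.
  (* Only [p] and its transpose contribute, each with [c]; for a diagonal [p] the value [c] is
     harmlessly counted twice. *)
  apply: (@le_trans _ _ (\sum_q ((q == p)%:R * c + (q == sw p)%:R * c))).
    rewrite big_mkcond /=; apply: ler_sum => q _.
    case: ifPn => [Qq|_]; last by rewrite addr_ge0 ?mulr_ge0.
    have /andP[q1 q2] := Qq; rewrite ![_ == i]eq_sym in q1 q2.
    have [->|qp] := eqVneq q p; first by rewrite mul1r -/E Gsq lerDl mulr_ge0.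
    have [->|qs] := eqVneq q (sw p).
      rewrite mul0r mul1r add0r -Gsq le_eqVlt; apply/orP; left; apply/eqP.
      congr E; apply/funext => t; congr (_ * _); rewrite /G /= F_symm /xi.
      by rewrite [p.2 == _]eq_sym [w p.2 t * _]mulrC.
    have -> : (fun t => G p t * G q t) =
        fun t => F p.1 p.2 t * F q.1 q.2 t * (xi p.1 p.2 t * xi q.1 q.2 t).
      by apply/funext => t; rewrite /G; ring.
    have h1 : (q.1, q.2) != (p.1, p.2) by rewrite -!surjective_pairing.
    have h2 : (q.1, q.2) != (p.2, p.1) by rewrite -surjective_pairing.
    by rewrite -/E (cross p1 p2 q1 q2 h1 h2) !mul0r addr0.
  have one (a : 'I_n * 'I_n) : \sum_q (q == a)%:R * c = c.
    rewrite (bigD1 a) //= eqxx mul1r big1 ?addr0 // => q qa.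
    by rewrite (negbTE qa) mul0r.
  rewrite big_split /= !one.
  have := diag p1 p2; rewrite -/(G p _) -/c => hd.
  have -> : 512 / n%:R ^+ 2 = 2 * (256 / n%:R ^+ 2) :> R by field; rewrite gt_eqF.
  by rewrite -mulrA; move: hd; move: (256 / _ * _) => e hd; lra.
apply: (le_trans (ler_sum _ step)).
rewrite -mulr_sumr.
have F2 p : em (fun t => F p.1 p.2 t ^+ 2).
  have -> : (fun t => F p.1 p.2 t ^+ 2) = fun t => F p.1 p.2 t * F p.1 p.2 t.
    by apply/funext => t; rewrite expr2.
  by apply: even_momentsM; exact: F_em.
have -> : 512 * eta^-1 ^+ 2 / n%:R = 512 / n%:R ^+ 2 * (n%:R * eta^-1 ^+ 2) :> R.
  by field; rewrite !gt_eqF.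
apply: ler_wpM2l; first by apply: divr_ge0; [exact: ler0n|exact: sqr_ge0].
rewrite -[leRHS](mean_cst P) /E -(mean_sum _ (fun p _ => F2 p)); apply: le_mean.
- by apply: even_moments_sum => p _; exact: F2.
- exact: even_moments_cst.
move=> t; apply: le_trans (F_sum t); rewrite pair_big /= big_mkcond /=.
by apply: ler_sum => p _; case: ifP => // _; exact: sqr_ge0.
Qed.

End WignerRow.

Section RayleighTail.
Context d (T : measurableType d) (R : realType) (P : probability T R).
Variables (n : nat) (X : 'I_n -> 'I_n -> {RV P >-> R}).
Hypothesis X_iid : iid_std_gaussian X.

Lemma measurable_wigner (i j : 'I_n) :
  measurable_fun setT (fun t => wigner (\matrix_(i, j) X i j t) i j).
Proof.
under eq_fun do rewrite mxE; case: eqP => _; first exact: measurable_cst.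
rewrite /gbar; under eq_fun do rewrite !mxE.
apply: measurable_funM => //; apply: measurable_funM => //.
by apply: measurable_funD; exact: measurable_funP.
Qed.

(** On the event the fluctuations have average modulus at least [s = eta * c / 2], so their squares
    sum to at least [n * s^2], whereas that sum has bounded mean: Markov's inequality gives a
    probability of order [1 / n]. *)
Lemma wigner_rayleigh_tail (x eta : R) : 0 < eta -> eta < x -> x < 2 -> (0 < n)%N ->
  2 * eta^-1 ^+ 2 <= (1 - x ^+ 2 / 4) * n%:R ->
  (P [set t | rayleigh_le (x - eta) (wigner (\matrix_(i, j) X i j t))] <=
   (2048 / (eta ^+ 4 * (1 - x ^+ 2 / 4) ^+ 2) / n%:R)%:E)%E.
Proof.
move=> eta0 etax x2 n_gt0 hn; have n0 : 0 < n%:R :> R by rewrite ltr0n.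
set c := 1 - x ^+ 2 / 4; set A := [set t | _].
have c0 : 0 < c by rewrite /c; have x0 := lt_trans eta0 etax; nra.
pose Z i := cut_fluct X x eta i.
pose f t := \sum_i Z i t ^+ 2.
have Z2 i : even_moments P (fun t => Z i t ^+ 2).
  have -> : (fun t => Z i t ^+ 2) = fun t => Z i t * Z i t.
    by apply/funext => t; rewrite expr2.
  have h : even_moments P (Z i) by exact: cut_fluct_even_moments.
  exact: even_momentsM.
have fm : even_moments P f by apply: even_moments_sum => i _; exact: Z2.
have mf : mean P f <= 512 * eta^-1 ^+ 2.
  rewrite /f (mean_sum _ (fun i _ => Z2 i)).
  apply: (@le_trans _ _ (\sum_(i < n) 512 * eta^-1 ^+ 2 / n%:R)).
    by apply: ler_sum => i _; exact: mean_cut_fluct_sqr.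
  by rewrite sumr_const card_ord -[_ *+ n]mulr_natr mulfVK // gt_eqF.
pose s := eta * c / 2; have s0 : 0 < s by rewrite /s !mulr_gt0.
have Af t : A t -> n%:R * s ^+ 2 <= f t.
  pose W := wigner (\matrix_(i, j) X i j t).
  rewrite /A /= -/W => At.
  have := resolvent_fluct eta0 etax (wigner_sym _) _ At n_gt0.
  rewrite -/c => h.
  have {}h : c <= n%:R^-1 * (eta^-1 * \sum_i `|Z i t| + eta^-1 ^+ 2).
    have -> : \sum_i `|Z i t| = \sum_i `|schur_fluct x i W|.
      apply: eq_bigr => i _; congr `|_|; apply: cut_fluctE.
      by apply: rcdel_rayleigh_le => //; rewrite subr_ge0 ltW.
    by apply: h => i; rewrite mxE eqxx.
  (* The lower bound on [n] lets half of [c * n] absorb the error [eta^-2]; the other half remains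
     for the fluctuations. *)
  have h1 : n%:R * s <= \sum_i `|Z i t|.
    move: h; rewrite ler_pdivlMl // => h.
    have : eta^-1 * (n%:R * s) <= eta^-1 * \sum_i `|Z i t|.
      have -> : eta^-1 * (n%:R * s) = c * n%:R / 2.
        by rewrite /s; field; rewrite gt_eqF.
      by move: hn h; rewrite -/c; move: (\sum_i _) => S; lra.
    by rewrite ler_pM2l ?invr_gt0.
  have h2 i : 2 * s * `|Z i t| <= Z i t ^+ 2 + s ^+ 2.
    by rewrite -[Z i t ^+ 2]real_normK ?num_real //; have := sqr_ge0 (`|Z i t| - s); nra.
  have h3 : 2 * s * \sum_i `|Z i t| <= f t + n%:R * s ^+ 2.
    rewrite mulr_sumr; apply: (le_trans (ler_sum _ (fun i _ => h2 i))).
    by rewrite big_split /= sumr_const card_ord -[_ *+ n]mulr_natl.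
  have := ler_wpM2l (ltW s0) h1; rewrite mulrCA -expr2; lra.
have mA : measurable A by apply: measurable_rayleigh_le => i j; exact: measurable_wigner.
have ns : 0 < n%:R * s ^+ 2 by rewrite mulr_gt0 ?exprn_gt0.
apply: le_trans (mean_markov ns fm _ mA Af) _.
  by move=> t; apply: sumr_ge0 => i _; exact: sqr_ge0.
rewrite lee_fin; apply: (@le_trans _ _ ((n%:R * s ^+ 2)^-1 * (512 * eta^-1 ^+ 2))).
  by rewrite ler_wpM2l // invr_ge0 ltW.
rewrite le_eqVlt; apply/orP; left; apply/eqP; rewrite /s; field.
by rewrite !gt_eqF.
Qed.

End RayleighTail.

(** * The largest eigenvalue *)

Section Lambda1.
Variable R : realType.

Lemma rayleigh_le_exists n (M : 'M[R]_n) : exists2 K, 0 < K & rayleigh_le K M.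
Proof.
exists (1 + \sum_i \sum_j `|M i j|).
  by rewrite ltr_pwDl // sumr_ge0 // => i _; rewrite sumr_ge0.
move=> v; rewrite mulrDl mul1r dot_mulmxE -[leLHS]add0r lerD ?dot_ge0 //.
rewrite mulr_suml; apply: ler_sum => i _; rewrite mulr_suml; apply: ler_sum => j _.
have vi k : `|v k 0| ^+ 2 <= dot v v.
  rewrite real_normK ?num_real // /dot (bigD1 k) //= -expr2 lerDl.
  by apply: sumr_ge0 => l _; rewrite -expr2 sqr_ge0.
apply: le_trans (ler_norm _) _; rewrite !normrM mulrAC mulrC ler_wpM2l //.
by have := vi i; have := vi j; have := sqr_ge0 (`|v i 0| - `|v j 0|); nra.
Qed.

(** The operator inequality [N^2 <= K N] for [0 <= N <= K], obtained by testing positivity at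
    [v - K^-1 N v]. *)
Lemma psd_sqr_le n (N : 'M[R]_n) K : 0 < K -> N^T = N -> rayleigh_le K N ->
  (forall v, 0 <= dot v (N *m v)) ->
  forall v, dot (N *m v) (N *m v) <= K * dot v (N *m v).
Proof.
move=> K0 sN NK N0 v; set u := N *m v.
have := N0 (v - K^-1 *: u); rewrite mulmxBr -scalemxAr -/u.
rewrite dotBr !dotBl !dotZr !dotZl.
have -> : dot v (N *m u) = dot u u by rewrite dot_mulmx sN.
have := NK u; move: (dot u (N *m u)) (dot u u) (dot v u) => a b e h1 h2.
have h3 : K^-1 * (K^-1 * a) <= K^-1 * b.
  by rewrite ler_pM2l ?invr_gt0 // ler_pdivrMl.
have : K^-1 * b <= e by lra.
by rewrite ler_pdivrMl.
Qed.

Lemma eigenvalue_unitmx n (M : 'M[R]_n) a :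
  eigenvalue M a = (a%:M - M \notin unitmx).
Proof.
rewrite /eigenvalue /eigenspace kermx_eq0 row_free_unit -[M - _]opprB.
by rewrite -scaleN1r unitmxZ // unitrN1.
Qed.

(* The supremum [mu] of the Rayleigh quotients is an eigenvalue: were [mu - M]
   invertible, it would be coercive, contradicting the choice of [mu]. *)
Lemma lambda1_gt n (M : 'M[R]_n) eps : 0 < eps -> M^T = M ->
  eps < lambda1 M <-> ~ rayleigh_le eps M.
Proof.
move=> eps0 sM; have [K K0 MK] := rayleigh_le_exists M.
have ub_eig (c : R) : rayleigh_le c M -> ubound [set a | eigenvalue M a] c.
  move=> Mc a /= /eigenvalueP[v vM v0].
  have v1 : v^T != 0 by apply: contra v0 => /eqP/(congr1 trmx); rewrite trmxK trmx0 => ->.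
  have := Mc v^T; rewrite -{1}sM -trmx_mul vM linearZ dotZr ler_pM2r //.
  exact: dot_gt0.
split => [h Me|h].
  (* The supremum of the empty set is 0, which is below [eps]. *)
  have [E0|/set0P E0] := eqVneq [set a | eigenvalue M a] set0.
    by move: h; rewrite /lambda1 E0 sup0 ltNge ltW.
  by move: h; rewrite /lambda1 ltNge => /negP; apply; apply: ge_sup => //; exact: ub_eig.
have [v] : exists v, eps * dot v v < dot v (M *m v).
  by apply: contra_notP h => /forallNP h v; rewrite leNgt; apply/negP.
move=> hv; have v0 : v != 0.
  by apply: contraTN hv => /eqP ->; rewrite mulmx0 /dot !big1 ?mulr0 ?ltxx // => i _;
    rewrite mxE mul0r.
pose S := [set a | exists2 u : 'cV[R]_n, u != 0 & a = dot u (M *m u) / dot u u].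
have S_ub : has_ubound S.
  exists K => _ [u u0 ->]; rewrite ler_pdivrMr ?dot_gt0 //; exact: MK.
have S0 : S !=set0 by exists (dot v (M *m v) / dot v v); exists v.
pose mu := sup S.
have muM : rayleigh_le mu M.
  move=> u; have [->|u0] := eqVneq u 0.
    by rewrite mulmx0 /dot !big1 ?mulr0 // => i _; rewrite mxE mul0r.
  by rewrite -ler_pdivrMr ?dot_gt0 //; apply: ub_le_sup => //; exists u.
have mu_eps : eps < mu.
  apply: (@lt_le_trans _ _ (dot v (M *m v) / dot v v)).
    by rewrite ltr_pdivlMr ?dot_gt0.
  by apply: ub_le_sup => //; exists v.
suff mu_eig : eigenvalue M mu.
  apply: lt_le_trans mu_eps _; apply: ub_le_sup => //.
  by exists K; exact: ub_eig.
rewrite eigenvalue_unitmx; apply/negP => unitN.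
set N := mu%:M - M in unitN.
have sN : N^T = N by rewrite /N linearB /= tr_scalar_mx sM.
have NE u : dot u (N *m u) = mu * dot u u - dot u (M *m u).
  by rewrite mulmxBl mul_scalar_mx dotBr dotZr.
have N0 u : 0 <= dot u (N *m u) by rewrite NE subr_ge0; exact: muM.
have [K1 K10 NK1] := rayleigh_le_exists N.
have [K2 K20 NK2] := rayleigh_le_exists ((invmx N)^T *m invmx N).
(* The bound [K2] on the squared inverse controls [|u|^2] by [|N u|^2], and [psd_sqr_le] controls
   [|N u|^2] by the form of [N]. *)
have coer u : dot u u <= K2 * K1 * dot u (N *m u).
  have e1 : dot u u = dot (N *m u) ((invmx N)^T *m invmx N *m (N *m u)).
    by rewrite -mulmxA mulKmx // dot_mulmx trmxK mulKmx.
  rewrite e1 -mulrA; apply: le_trans (NK2 _) _; rewrite ler_pM2l //.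
  exact: psd_sqr_le.
have : mu <= mu - (K2 * K1)^-1.
  apply: ge_sup => // _ [u u0 ->]; rewrite ler_pdivrMr ?dot_gt0 //.
  have := coer u; rewrite NE.
  have k0 : 0 < K2 * K1 by rewrite mulr_gt0.
  rewrite -(ler_pdivrMl _ (dot u u) k0).
  by move: (_^-1) (dot u u) (dot u _) => k a b; lra.
by rewrite lerDl oppr_ge0 invr_le0 leNgt mulr_gt0.
Qed.

End Lambda1.

(** * The Hessian *)

Section Hessian.
Variables (R : realType) (N : nat).
Implicit Types (f g : 'rV[R]_N -> R) (x y v u : 'rV[R]_N).

Lemma is_derive_line f x v df :
  is_derive (0 : R) 1 (fun t : R => f (t *: v + x)) df -> is_derive x v f df.
Proof.
have e : (fun h : R => h^-1 *: (((fun t : R => f (t *: v + x)) \o shift 0) (h *: 1) -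
    (fun t : R => f (t *: v + x)) 0)) =
    (fun h : R => h^-1 *: ((f \o shift x) (h *: v) - f x)).
  apply/funext => h /=; rewrite addr0 scale0r add0r /GRing.scale /= mulr1 //.
by case; rewrite /derivable /derive e => h1 h2; exact: DeriveDef.
Qed.

Lemma is_derive_coord x v k (psi : R -> R) a :
  is_derive (x 0 k) 1 psi a -> is_derive x v (fun y => psi (y 0 k)) (a * v 0 k).
Proof.
move=> hp; apply: is_derive_line.
have -> : (fun t : R => psi ((t *: v + x) 0 k)) = psi \o (fun t => t * v 0 k + x 0 k).
  by apply/funext => t; rewrite /= !mxE.
apply: is_derive1_comp; first by rewrite mul0r add0r.
have h : is_derive (0 : R) 1 ((fun t => t * v 0 k) + cst (x 0 k)) (v 0 k + 0).
  apply: is_deriveD.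
  have -> : (fun t => t * v 0 k) = (v 0 k) \*: (@id R).
    by apply/funext => t; rewrite /= mulrC.
  by apply: is_derive_eq; rewrite /GRing.scale /= mulr1.
by rewrite addr0 in h.
Qed.

Lemma is_derive_id_coord x v k : is_derive x v (fun y => y 0 k) (v 0 k).
Proof.
by have := @is_derive_coord x v k id 1; rewrite mul1r; apply.
Qed.

Lemma is_derive_add f g x v df dg : is_derive x v f df -> is_derive x v g dg ->
  is_derive x v (fun y => f y + g y) (df + dg).
Proof. exact: is_deriveD. Qed.

Lemma is_derive_opp f x v df : is_derive x v f df ->
  is_derive x v (fun y => - f y) (- df).
Proof. exact: is_deriveN. Qed.

Lemma is_derive_mul f g x v df dg : is_derive x v f df -> is_derive x v g dg ->
  is_derive x v (fun y => f y * g y) (f x * dg + g x * df).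
Proof. exact: is_deriveM. Qed.

Lemma is_derive_const (c : R) x v : is_derive x v (fun=> c) 0.
Proof. exact: is_derive_cst. Qed.

Lemma is_derive_scale c f x v df : is_derive x v f df ->
  is_derive x v (fun y => c * f y) (c * df).
Proof. exact: is_deriveZ. Qed.

Lemma is_derive_bigsum (I : Type) (r : seq I) (Q : pred I)
    (f : I -> 'rV[R]_N -> R) (df : I -> R) x v :
  (forall i, is_derive x v (f i) (df i)) ->
  is_derive x v (fun y => \sum_(i <- r | Q i) f i y) (\sum_(i <- r | Q i) df i).
Proof.
move=> h; elim: r => [|i r IH].
  by under eq_fun do rewrite big_nil; rewrite big_nil; exact: is_derive_const.
rewrite big_cons; have [Qi|Qi] := boolP (Q i).
  by under eq_fun do rewrite big_cons Qi; exact: is_derive_add.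
by under eq_fun do rewrite big_cons (negbTE Qi).
Qed.

Lemma is_derive_affine (c a : R) : is_derive a 1 (cst 1 + c \*: (@id R)) c.
Proof.
have h : is_derive a 1 (cst 1 + c \*: (@id R)) (0 + c *: 1) by exact: is_deriveD.
by apply: (is_derive_eq h); rewrite add0r /GRing.scale /= mulr1.
Qed.

Lemma is_derive_ln_shift (c a : R) : 0 < 1 + c * a ->
  is_derive a 1 (fun a => ln (1 + c * a)) (c / (1 + c * a)).
Proof.
move=> h.
have := @is_derive1_comp R (@ln R) (cst 1 + c \*: (@id R)) a _ _
  (is_derive1_ln h) (is_derive_affine c a).
by rewrite mulrC; apply.
Qed.

Lemma is_derive_TAP_I2 (a : R) : `|a| < 1 ->
  is_derive a 1 (fun a => (ln (1 + a) - ln (1 - a)) / 2) (1 - a ^+ 2)^-1.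
Proof.
rewrite ltr_norml => /andP[a1 a2].
have h1 : 0 < 1 + 1 * a by lra.
have h2 : 0 < 1 + (-1) * a by lra.
have := is_deriveZ (2^-1) (is_deriveB (is_derive_ln_shift h1) (is_derive_ln_shift h2)).
have -> : (2^-1 \*: ((fun a : R => ln (1 + 1 * a)) - (fun a => ln (1 + -1 * a)))) =
    (fun a => (ln (1 + a) - ln (1 - a)) / 2).
  by apply/funext => b; rewrite !fctE /GRing.scale /= mul1r mulN1r mulrC.
move=> h; apply: (is_derive_eq h); rewrite /GRing.scale /=; field.
by repeat (apply/andP; split); apply/eqP => h3; move: h3; nra.
Qed.

Lemma is_derive_TAP_I (a : R) : `|a| < 1 ->
  is_derive a 1 (@TAP_I R) ((ln (1 + a) - ln (1 - a)) / 2).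
Proof.
rewrite ltr_norml => /andP[a1 a2].
have h1 : 0 < 1 + 1 * a by lra.
have h2 : 0 < 1 + (-1) * a by lra.
have l1 (c : R) : is_derive a 1 (fun a => (1 + c * a) / 2) (c / 2).
  have := is_deriveZ (2^-1) (is_derive_affine c a).
  have -> : 2^-1 \*: (cst 1 + c \*: (@id R)) = (fun a => (1 + c * a) / 2).
    by apply/funext => b; rewrite !fctE /GRing.scale /= mulrC.
  by move=> h; apply: (is_derive_eq h); rewrite /GRing.scale /=; ring.
have := is_deriveD (is_deriveM (l1 1) (is_derive_ln_shift h1))
  (is_deriveM (l1 (-1)) (is_derive_ln_shift h2)).
have -> : (fun a : R => (1 + 1 * a) / 2) * (fun a => ln (1 + 1 * a)) +
   (fun a => (1 + -1 * a) / 2) * (fun a => ln (1 + -1 * a)) = @TAP_I R.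
  by apply/funext => b; rewrite !fctE /TAP_I /= mul1r mulN1r.
move=> h; apply: (is_derive_eq h); rewrite /GRing.scale /= !mul1r !mulN1r; field.
by repeat (apply/andP; split); apply/eqP => h3; move: h3; nra.
Qed.

Variables (beta h : R) (g : 'M[R]_N).

Let c1 := beta / Num.sqrt N%:R.
Let dI (a : R) := (ln (1 + a) - ln (1 - a)) / 2.

Let dTAP v y := c1 * (\sum_(i < N) \sum_(j < N | (i < j)%N)
     gbar g i j * (v 0 i * y 0 j + y 0 i * v 0 j))
  + h * (\sum_(i < N) v 0 i)
  - beta ^+ 2 * (1 - N%:R^-1 * \sum_(i < N) y 0 i ^+ 2) * (\sum_(i < N) y 0 i * v 0 i)
  - \sum_(i < N) dI (y 0 i) * v 0 i.

Let ddTAP v u y := c1 * (\sum_(i < N) \sum_(j < N | (i < j)%N)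
     gbar g i j * (v 0 i * u 0 j + u 0 i * v 0 j))
  + 2 * beta ^+ 2 / N%:R * (\sum_(i < N) y 0 i * v 0 i) * (\sum_(i < N) y 0 i * u 0 i)
  - beta ^+ 2 * (1 - N%:R^-1 * \sum_(i < N) y 0 i ^+ 2) * (\sum_(i < N) u 0 i * v 0 i)
  - \sum_(i < N) (1 - y 0 i ^+ 2)^-1 * u 0 i * v 0 i.

Let is_derive_sumsq y v : is_derive y v (fun y => \sum_(i < N) y 0 i ^+ 2)
   (\sum_(i < N) 2 * (y 0 i * v 0 i)).
Proof.
apply: is_derive_bigsum => i.
have := is_derive_mul (is_derive_id_coord y v i) (is_derive_id_coord y v i).
have -> : (fun y : 'rV[R]_N => y 0 i * y 0 i) = (fun y => y 0 i ^+ 2).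
  by apply/funext => z; rewrite expr2.
by rewrite -mulr2n mulr_natl.
Qed.

Let is_derive_TAP y v : (forall i, `|y 0 i| < 1) ->
  is_derive y v (TAP beta h g) (dTAP v y).
Proof.
move=> y1; rewrite /TAP -/c1.
have h1 := is_derive_scale c1 (is_derive_bigsum (index_enum 'I_N) predT
  (fun i => is_derive_bigsum (index_enum 'I_N) (fun j => (i < j)%N)
  (fun j => is_derive_mul (is_derive_scale (gbar g i j) (is_derive_id_coord y v i))
     (is_derive_id_coord y v j)))).
have h2 := is_derive_scale h (is_derive_bigsum (index_enum 'I_N) predT
   (fun i => is_derive_id_coord y v i)).
have h3 := is_derive_add (is_derive_const 1 y v)
  (is_derive_opp (is_derive_scale N%:R^-1 (is_derive_sumsq y v))).
have h4 := is_derive_scale (beta ^+ 2 / 4 * N%:R) (is_derive_mul h3 h3).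
have h5 := is_derive_opp (is_derive_bigsum (index_enum 'I_N) predT
   (fun i => is_derive_coord v (is_derive_TAP_I (y1 i)))).
apply: (is_derive_eq (is_derive_add (is_derive_add (is_derive_add h1 h2) h4) h5)).
rewrite /dTAP; congr (_ + _ + _ + _).
- congr (_ * _); apply: eq_bigr => i _; apply: eq_bigr => j _; ring.
- have [N0|N0] := eqVneq N%:R (0 : R).
    rewrite N0 mulr0 mul0r; move/eqP: N0; rewrite pnatr_eq0 => /eqP N0.
    rewrite [X in _ * X]big1 ?mulr0 ?oppr0 // => i.
    by have := ltn_ord i; rewrite {2}N0.
  by rewrite -mulr_sumr; field.
Qed.

Let is_derive_dTAP x v u : (forall i, `|x 0 i| < 1) ->
  is_derive x u (dTAP v) (ddTAP v u x).
Proof.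
move=> x1; rewrite /dTAP.
have h1 := is_derive_scale c1 (is_derive_bigsum (index_enum 'I_N) predT
  (fun i => is_derive_bigsum (index_enum 'I_N) (fun j => (i < j)%N)
  (fun j => is_derive_scale (gbar g i j) (is_derive_add
     (is_derive_scale (v 0 i) (is_derive_id_coord x u j))
     (is_derive_mul (is_derive_id_coord x u i) (is_derive_const (v 0 j) x u)))))).
have h2 := is_derive_const (h * (\sum_(i < N) v 0 i)) x u.
have h3 := is_derive_add (is_derive_const 1 x u)
  (is_derive_opp (is_derive_scale N%:R^-1 (is_derive_sumsq x u))).
have h4 := is_derive_bigsum (index_enum 'I_N) predT
   (fun i => is_derive_mul (is_derive_id_coord x u i) (is_derive_const (v 0 i) x u)).
have h5 := is_derive_opp (is_derive_mul (is_derive_scale (beta ^+ 2) h3) h4).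
have h6 := is_derive_opp (is_derive_bigsum (index_enum 'I_N) predT
   (fun i => is_derive_mul (is_derive_coord u (is_derive_TAP_I2 (x1 i)))
      (is_derive_const (v 0 i) x u))).
apply: (is_derive_eq (is_derive_add (is_derive_add (is_derive_add h1 h2) h5) h6)).
rewrite /ddTAP addr0 -!addrA; congr (_ + _).
  congr (_ * _); apply: eq_bigr => i _; apply: eq_bigr => j _; ring.
rewrite addrA; congr (_ + _).
  have -> : \sum_(i < N) (x 0 i * 0 + v 0 i * u 0 i) = \sum_(i < N) u 0 i * v 0 i.
    by apply: eq_bigr => i _; ring.
  rewrite -mulr_sumr.
  move: (\sum_(i < N) u 0 i * v 0 i) (\sum_(i < N) x 0 i ^+ 2) => A B.
  move: (\sum_(i < N) x 0 i * v 0 i) (\sum_(i < N) x 0 i * u 0 i) => C D.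
  ring.
by congr (- _); apply: eq_bigr => i _; ring.
Qed.

Lemma hessian_TAP x : (forall i, `|x 0 i| < 1) ->
  hessian (TAP beta h g) x = beta *: wigner g
   + (2 * beta ^+ 2 / N%:R) *: (x^T *m x)
   - (beta ^+ 2 * (1 - N%:R^-1 * \sum_(i < N) x 0 i ^+ 2))%:M
   - \matrix_(i, j) ((i == j)%:R / (1 - x 0 i ^+ 2)).
Proof.
move=> x1; apply/matrixP => i j; rewrite [LHS]mxE.
have -> : 'D_(delta_mx 0 i) ('D_(delta_mx 0 j) (TAP beta h g)) x =
    'D_(delta_mx 0 i) (dTAP (delta_mx 0 j)) x.
  (* The closed form of the first derivative is valid only inside the open cube, so it may replace
     the derivative merely near [x]. *)
  apply: near_eq_derive; near=> y.
  have y1 : forall k, `|y 0 k| < 1.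
    near: y; apply: filter_forall => k.
    have /cvgr_norm_lt := @coord_continuous R 1 N 0 k x.
    by apply.
  by have [_ ->] := is_derive_TAP (delta_mx 0 j) y1.
have [_ ->] := is_derive_dTAP (delta_mx 0 j) (delta_mx 0 i) x1.
have dl (F : 'I_N -> R) k : \sum_l F l * (delta_mx 0 k : 'rV[R]_N) 0 l = F k.
  rewrite (bigD1 k) //= big1 ?addr0 => [|l lk]; rewrite mxE ?eqxx ?mulr1 //=.
  by rewrite (negbTE lk) mulr0.
rewrite /ddTAP !dl.
have -> : \sum_(k < N) \sum_(l < N | (k < l)%N) gbar g k l *
    ((delta_mx 0 j : 'rV[R]_N) 0 k * (delta_mx 0 i : 'rV[R]_N) 0 l +
     (delta_mx 0 i : 'rV[R]_N) 0 k * (delta_mx 0 j : 'rV[R]_N) 0 l) =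
    if i == j then 0 else gbar g i j.
  (* The sum over [k < l] sees a pair of basis vectors in one order only; of the two symmetric terms
     exactly one survives when [i != j], and none when [i = j]. *)
  have e1 (a b : 'I_N) : \sum_(k < N) \sum_(l < N | (k < l)%N) gbar g k l *
      ((delta_mx 0 a : 'rV[R]_N) 0 k * (delta_mx 0 b : 'rV[R]_N) 0 l) =
      if (a < b)%N then gbar g a b else 0.
    under eq_bigr do rewrite big_mkcond /=.
    rewrite (bigD1 a) //= [X in _ + X]big1 ?addr0 => [|k ka]; last first.
      by apply: big1 => l _; rewrite !mxE (negbTE ka) mul0r mulr0 if_same.
    rewrite (bigD1 b) //= big1 ?addr0 => [|l lb]; last first.
      by rewrite !mxE (negbTE lb) mulr0 mulr0 if_same.
    by rewrite !mxE !eqxx !mulr1.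
  under eq_bigr do under eq_bigr do rewrite mulrDr.
  under eq_bigr do rewrite big_split /=.
  rewrite big_split /= !e1 -val_eqE /=.
  by case: ltngtP => // _; rewrite ?add0r ?addr0 // /gbar [g j i + _]addrC.
rewrite !mxE big_ord1 !mxE eqxx /=.
have N0 : 0 < N%:R :> R by rewrite ltr0n (leq_ltn_trans _ (ltn_ord i)).
have sN0 : Num.sqrt N%:R != 0 :> R by rewrite gt_eqF // sqrtr_gt0.
have x2 k : 1 - x 0 k ^+ 2 != 0.
  rewrite subr_eq0 eq_sym lt_eqF // -[x 0 k ^+ 2]real_normK ?num_real //.
  by rewrite expr_lt1.
by have [->|ij] := eqVneq i j; rewrite ?eqxx /= /c1; field;
  rewrite ?x2 ?sN0 ?gt_eqF.
Unshelve. all: by end_near.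
Qed.

End Hessian.

(** * The choice of m *)

Section Profile.
Variable R : realType.

Definition profile_value (c : 'I_4) : R :=
  if c == 0 :> nat then 0 else if c == 1 :> nat then 3 / 5 else
  if c == 2 :> nat then 1 / 2 else - (1 / 2).

Lemma profile_value_lt1 c : `|profile_value c| < 1.
Proof. by rewrite /profile_value ltr_norml; do 3?case: ifP => _; lra. Qed.

(* The right-hand side is, up to [tau], the quadratic form of the Hessian at a
   vector supported on the block. *)
Lemma profile_exists n (W : 'M[R]_n) (v : 'cV[R]_n) (y tau : R) :
  (0 < n)%N -> v != 0 -> 49 / 50 <= y <= 99 / 100 -> tau <= 1 / 100 ->
  (2 - 1 / 100) * dot v v <= dot v (W *m v) ->
  exists a : 'I_n -> 'I_4, let m i := profile_value (a i) in
    1 / 100 * dot v v <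
    y * dot v (W *m v) + 2 * y ^+ 2 / n%:R * (\sum_i m i * v i 0) ^+ 2
    - (y ^+ 2 / n%:R * (\sum_i (1 - m i ^+ 2)) + tau) * dot v v
    - \sum_i v i 0 ^+ 2 / (1 - m i ^+ 2).
Proof.
move=> n_gt0 v0 /andP[y1 y2] htau hW.
have n0 : 0 < n%:R :> R by rewrite ltr0n.
have D0 : 0 < dot v v by exact: dot_gt0.
have y0 : 0 <= y by lra.
have yW : y * ((2 - 1 / 100) * dot v v) <= y * dot v (W *m v) by rewrite ler_wpM2l.
have DE : dot v v = \sum_i v i 0 ^+ 2 by apply: eq_bigr => i _; rewrite expr2.
have yy : y ^+ 2 <= y by rewrite expr2 ler_piMl //; lra.
pose S := \sum_i `|v i 0|.
have S0 : 0 <= S by apply: sumr_ge0.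
(* The cut is at l^1 norm [3/5 sqrt n |v|]. Above it the sign profile earns [9/50 y^2] from the rank
   one term, which leaves about [2 y - 57/100 y^2 - 4/3], positive near [y = 1]. *)
have [hS|hS] := leP (9 / 25 * (n%:R * dot v v)) (S ^+ 2).
  exists (fun i => if 0 <= v i 0 then inord 2 else inord 3) => m.
  have mE i : m i = if 0 <= v i 0 then 1 / 2 else - (1 / 2).
    by rewrite /m /profile_value; case: (0 <= v i 0); rewrite inordK.
  have m2 i : m i ^+ 2 = 1 / 4 by rewrite mE; case: ifP => _; field.
  have -> : \sum_i m i * v i 0 = S / 2.
    rewrite /S mulr_suml; apply: eq_bigr => i _; rewrite mE.
    by case: ger0P => _; field.
  have -> : \sum_i (1 - m i ^+ 2) = n%:R * (3 / 4).
    under eq_bigr do rewrite m2; rewrite sumr_const card_ord -[_ *+ n]mulr_natl.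
    by congr (_ * _); field.
  have -> : \sum_i v i 0 ^+ 2 / (1 - m i ^+ 2) = 4 / 3 * dot v v.
    by rewrite DE mulr_sumr; apply: eq_bigr => i _; rewrite m2; field.
  have -> : y ^+ 2 / n%:R * (n%:R * (3 / 4)) = y ^+ 2 * (3 / 4).
    by field; rewrite gt_eqF.
  have h1 : y ^+ 2 * (9 / 50) * dot v v <= 2 * y ^+ 2 / n%:R * (S / 2) ^+ 2.
    have -> : 2 * y ^+ 2 / n%:R * (S / 2) ^+ 2 = y ^+ 2 / 2 * (n%:R^-1 * S ^+ 2).
      by field; rewrite gt_eqF.
    have h : 9 / 25 * dot v v <= n%:R^-1 * S ^+ 2.
      by rewrite ler_pdivlMl // mulrCA.
    have y20 : 0 <= y ^+ 2 / 2 by rewrite divr_ge0 ?sqr_ge0.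
    by have := ler_wpM2l y20 h; lra.
  have h2 : 1 / 100 * dot v v < (y * (2 - 1 / 100) + y ^+ 2 * (9 / 50) -
      y ^+ 2 * (3 / 4) - tau - 4 / 3) * dot v v.
    by rewrite ltr_pM2r //; lra.
  lra.
pose r := Num.sqrt (dot v v / n%:R).
have r0 : 0 < r by rewrite sqrtr_gt0 divr_gt0.
have r2 : n%:R * r ^+ 2 = dot v v.
  by rewrite sqr_sqrtr ?ltW ?divr_gt0 // mulrC divfK // gt_eqF.
have Sr : S < 3 / 5 * (n%:R * r).
  rewrite -(@ltr_pXn2r _ 2) ?nnegrE ?mulr_ge0 ?(ltW r0) ?(ltW n0) //.
  have -> : (3 / 5 * (n%:R * r)) ^+ 2 = 9 / 25 * (n%:R * (n%:R * r ^+ 2)) by field.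
  by rewrite r2.
(* Here [r] is the root mean square of the coordinates. The values 0 and 3/5 cost the same in
   [r^2 (1 - m^2) + v_i^2 / (1 - m^2)] when [|v_i| = 4/5 r], and each coordinate gets the cheaper
   one. *)
exists (fun i => if 4 / 5 * r < `|v i 0| then inord 0 else inord 1) => m.
have mE i : m i = if 4 / 5 * r < `|v i 0| then 0 else 3 / 5.
  by rewrite /m /profile_value; case: (_ < `|v i 0|); rewrite inordK.
(* The excess is bounded linearly in [|v_i|], so that its sum is governed by the l^1 norm; in both
   cases equality holds at the threshold. *)
have hi i : r ^+ 2 * (1 - m i ^+ 2) + v i 0 ^+ 2 / (1 - m i ^+ 2) <=
    16 / 25 * r ^+ 2 + v i 0 ^+ 2 + 9 / 20 * (r * `|v i 0|).
  rewrite mE; case: ltP => hv.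
    rewrite expr0n subr0 divr1 mulr1.
    by have := ler_wpM2l (ltW r0) (ltW hv); lra.
  have -> : 1 - (3 / 5) ^+ 2 = 16 / 25 :> R by field.
  have : `|v i 0| * `|v i 0| <= 4 / 5 * r * `|v i 0| by rewrite ler_wpM2r.
  rewrite -expr2 real_normK ?num_real // => h.
  have -> : v i 0 ^+ 2 / (16 / 25) = v i 0 ^+ 2 + 9 / 16 * v i 0 ^+ 2 by field.
  lra.
(* [16/25 + 1 + 9/20 * 3/5 = 191/100], to be compared with 2 for [m = 0]. *)
have hs : r ^+ 2 * (\sum_i (1 - m i ^+ 2)) + \sum_i v i 0 ^+ 2 / (1 - m i ^+ 2) <=
    191 / 100 * dot v v.
  rewrite mulr_sumr -big_split /=; apply: (le_trans (ler_sum _ (fun i _ => hi i))).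
  rewrite !big_split /= -DE -!mulr_sumr -/S sumr_const card_ord -[_ *+ n]mulr_natl.
  by have := ler_wpM2l (ltW r0) (ltW Sr); rewrite -r2; lra.
have h3 : 0 <= 2 * y ^+ 2 / n%:R * (\sum_i m i * v i 0) ^+ 2.
  by rewrite mulr_ge0 ?sqr_ge0 // divr_ge0 ?(ltW n0) // mulr_ge0 ?sqr_ge0.
have h4 : y ^+ 2 / n%:R * (\sum_i (1 - m i ^+ 2)) * dot v v <=
    r ^+ 2 * (\sum_i (1 - m i ^+ 2)).
  have -> : y ^+ 2 / n%:R * (\sum_i (1 - m i ^+ 2)) * dot v v =
      y ^+ 2 * (r ^+ 2 * (\sum_i (1 - m i ^+ 2))).
    by rewrite -r2; field; rewrite gt_eqF.
  rewrite ler_piMl //; last lra.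
  apply: mulr_ge0; first exact: sqr_ge0.
  apply: sumr_ge0 => i _; rewrite mE; case: ifP => _; first by rewrite expr0n subr0.
  by rewrite (_ : 1 - _ = 16 / 25 :> R) //; field.
have h5 : tau * dot v v <= 1 / 100 * dot v v by apply: ler_wpM2r => //; exact: ltW.
have h6 : 49 / 50 * ((2 - 1 / 100) * dot v v) <= y * ((2 - 1 / 100) * dot v v).
  by apply: ler_wpM2r => //; apply: mulr_ge0; [lra|exact: ltW].
rewrite mulrDl; lra.
Qed.

End Profile.

(** * Measurable selection and restriction to a block *)

Lemma iid_std_gaussian_sub d (T : measurableType d) (R : realType)
    (P : probability T R) N n (f : 'I_n -> 'I_N)
    (X : 'I_N -> 'I_N -> {RV P >-> R}) :
  injective f -> iid_std_gaussian X -> iid_std_gaussian (fun i j => X (f i) (f j)).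
Proof.
move=> f_inj [X_indep X_gauss]; split; last by move=> i j; exact: X_gauss.
move=> J B mB.
pose F (ij : 'I_n * 'I_n) := (f ij.1, f ij.2).
have F_inj : injective F by move=> [a b] [a' b'] [/f_inj -> /f_inj ->].
pose B' kl := if [pick ij | F ij == kl] is Some ij then B ij else setT.
have B'F ij : B' (F ij) = B ij.
  rewrite /B'; case: pickP => [kl /eqP /F_inj -> //|/(_ ij)].
  by rewrite eqxx.
have mB' kl : measurable (B' kl) by rewrite /B'; case: pickP.
have := X_indep (F @: J)%SET B' mB'.
rewrite big_imset /=; last by move=> a b _ _; exact: F_inj.
have -> : \bigcap_(kl in [set` (F @: J)%SET]) X kl.1 kl.2 @^-1` B' kl =
    \bigcap_(ij in [set` J]) X (f ij.1) (f ij.2) @^-1` B ij.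
  apply/seteqP; split => [t h ij /= Jij|t h kl /= /imsetP[ij Jij ->]].
    by have := h (F ij) (imset_f F Jij); rewrite /= B'F.
  by rewrite B'F; exact: h.
by move=> ->; apply: eq_bigr => ij _; rewrite B'F.
Qed.

(** Takes the first index of the enumeration whose event occurs, and [c0] if there is none. *)
Lemma measurable_selection d (T : measurableType d) (R : realType) (C : finType)
    (c0 : C) (Ev : C -> set T) : (forall c, measurable (Ev c)) ->
  exists sel : T -> C, (forall F : C -> R, measurable_fun setT (F \o sel)) /\
    (forall t c, Ev c t -> Ev (sel t) t).
Proof.
move=> mE.
pose sel (s : seq C) t := foldr (fun c acc => if `[< Ev c t >] then c else acc) c0 s.
exists (sel (enum C)); split => [F|t c Ect].
  elim: (enum C) => [|c s IH].
    by rewrite (_ : _ \o _ = cst (F c0)).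
  rewrite (_ : _ \o _ = fun t => if `[< Ev c t >] then F c else (F \o sel s) t).
    apply: measurable_fun_ifT => //; apply: (measurable_fun_bool true).
    rewrite setTI (_ : _ @^-1` _ = Ev c) //.
    by apply/seteqP; split => t /= /asboolP.
  by apply/funext => t /=; case: ifP.
have : c \in enum C by rewrite mem_enum.
elim: (enum C) => [//|c' s IH]; rewrite inE /=.
by case: asboolP => // nE /predU1P[cc'|//]; rewrite -cc' in nE.
Qed.

Section Block.
Variables (R : realType) (N n : nat) (le_nN : (n <= N)%N).
Implicit Types (v : 'cV[R]_n) (c : {ffun 'I_N -> 'I_4}).

(** Outside the block [1 - m_i^2] is at most [2 kappa], negligible in averages. The huge diagonal
    entries that this creates in the Hessian are invisible to vectors supported on the block. *)
Definition block_profile (kappa : R) c : 'rV[R]_N :=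
  \row_i if (i < n)%N then profile_value R (c i) else 1 - kappa.

Definition block_sub (g : 'M[R]_N) : 'M[R]_n :=
  \matrix_(i, j) g (widen_ord le_nN i) (widen_ord le_nN j).

Definition block_col v : 'cV[R]_N :=
  \col_i if insub (i : nat) is Some j then v j 0 else 0.

Lemma sum_block (F : 'I_N -> R) : \sum_i F i =
  \sum_i F (widen_ord le_nN i) + \sum_(i < N | ~~ (i < n)%N) F i.
Proof. by rewrite (bigID (fun i : 'I_N => (i < n)%N)) /= big_ord_narrow. Qed.

Lemma sum_block_col v (F : 'I_N -> R) :
  \sum_i block_col v i 0 * F i = \sum_i v i 0 * F (widen_ord le_nN i).
Proof.
rewrite sum_block [X in _ + X]big1 ?addr0 => [|i ni].
  by apply: eq_bigr => i _; rewrite mxE (valK i).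
by rewrite mxE insubN // mul0r.
Qed.

Lemma block_profile_lt1 kappa c i : 0 < kappa < 1 ->
  `|block_profile kappa c 0 i| < 1.
Proof.
move=> /andP[k0 k1]; rewrite mxE; case: ifP => _; first exact: profile_value_lt1.
by rewrite ltr_norml; lra.
Qed.

Lemma block_profile_Plefka1 kappa c beta : 0 < kappa < 1 ->
  beta ^+ 2 * n%:R / N%:R + beta ^+ 2 * (2 * kappa) ^+ 2 < 1 ->
  Plefka1 beta (block_profile kappa c).
Proof.
move=> k01 h; split.
  by move=> i; rewrite -ler_norml ltW // block_profile_lt1.
have /andP[k0 k1] := k01.
apply: le_lt_trans h; rewrite sum_block.
have h1 : \sum_(i < n) (1 - block_profile kappa c 0 (widen_ord le_nN i) ^+ 2) ^+ 2 <= n%:R.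
  rewrite -[n in n%:R]card_ord -sumr_const; apply: ler_sum => i _.
  have := block_profile_lt1 c (widen_ord le_nN i) k01.
  move: (block_profile _ _ _ _) => z; rewrite ltr_norml => /andP[z1 z2].
  have z3 : 0 <= z ^+ 2 <= 1 by rewrite sqr_ge0 /=; nra.
  by rewrite expr_le1 //; lra.
have h2 : \sum_(i < N | ~~ (i < n)%N) (1 - block_profile kappa c 0 i ^+ 2) ^+ 2 <=
    N%:R * (2 * kappa) ^+ 2.
  rewrite big_mkcond -[N in N%:R]card_ord mulr_natl -sumr_const /=.
  apply: ler_sum => i _; case: ifPn => [ni|_]; last exact: sqr_ge0.
  rewrite mxE (negbTE ni).
  have -> : 1 - (1 - kappa) ^+ 2 = kappa * (2 - kappa) by ring.
  by apply: lerXn2r; rewrite ?nnegrE; nra.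
have [->|N0] := eqVneq N%:R (0 : R).
  by rewrite invr0 !(mulr0, mul0r) add0r mulr_ge0 ?sqr_ge0.
have N1 : 0 < N%:R :> R by rewrite lt_neqAle eq_sym N0 ler0n.
have b0 : 0 <= beta ^+ 2 / N%:R by rewrite divr_ge0 ?sqr_ge0 ?ler0n.
apply: le_trans (ler_wpM2l b0 (lerD h1 h2)) _.
by rewrite le_eqVlt; apply/orP; left; apply/eqP; field.
Qed.

(** Renormalising the Wigner block from [sqrt N] to [sqrt n] turns [beta] into [y], and
    [beta^2 / N = y^2 / n] brings the other terms to the same form. The only loss is the
    contribution of the outer coordinates to the average of [1 - m_i^2]. *)
Lemma block_hessian kappa beta h c (g : 'M[R]_N) v : (0 < n)%N -> 0 < kappa < 1 ->
  let y := beta * (Num.sqrt n%:R / Num.sqrt N%:R) in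
  let m i := profile_value R (c (widen_ord le_nN i)) in
  let V := block_col v in
  is_true (y * dot v (wigner (block_sub g) *m v)
    + 2 * y ^+ 2 / n%:R * (\sum_i m i * v i 0) ^+ 2
    - (y ^+ 2 / n%:R * (\sum_i (1 - m i ^+ 2)) + 2 * beta ^+ 2 * kappa) * dot v v
    - \sum_i v i 0 ^+ 2 / (1 - m i ^+ 2)
  <= dot V (hessian (TAP beta h g) (block_profile kappa c) *m V)).
Proof.
move=> n_gt0 k01 y m V; have /andP[k0 k1] := k01.
have n0 : 0 < n%:R :> R by rewrite ltr0n.
have N0 : 0 < N%:R :> R by rewrite ltr0n (leq_trans n_gt0).
have sn0 : Num.sqrt n%:R != 0 :> R by rewrite gt_eqF // sqrtr_gt0.
have sN0 : Num.sqrt N%:R != 0 :> R by rewrite gt_eqF // sqrtr_gt0.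
have y2 : y ^+ 2 = beta ^+ 2 * n%:R / N%:R.
  by rewrite exprMn expr_div_n !sqr_sqrtr ?ler0n // mulrA.
set x := block_profile kappa c.
have xw i : x 0 (widen_ord le_nN i) = m i by rewrite mxE /= ltn_ord.
rewrite hessian_TAP; last by move=> i; exact: block_profile_lt1.
rewrite !mulmxBl mulmxDl !dotBr dotDr -!scalemxAl !dotZr mul_scalar_mx dotZr.
have VV : dot V V = dot v v.
  rewrite {1}/dot sum_block_col; apply: eq_bigr => i _.
  by rewrite [V _ _]mxE (valK i).
have t1 : dot V (wigner g *m V) =
    Num.sqrt n%:R / Num.sqrt N%:R * dot v (wigner (block_sub g) *m v).
  rewrite {1}/dot sum_block_col mulr_sumr; apply: eq_bigr => i _.
  rewrite !mxE mulrCA; congr (_ * _).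
  rewrite (eq_bigr (fun j => V j 0 * wigner g (widen_ord le_nN i) j)); last first.
    by move=> j _; rewrite mulrC.
  rewrite sum_block_col mulr_sumr; apply: eq_bigr => j _.
  rewrite !mxE -val_eqE /= val_eqE; case: eqP => _; first by rewrite mul0r !mulr0.
  by rewrite /gbar !mxE; field; rewrite sn0 sN0 gt_eqF // sqrtr_gt0.
have t2 : dot V (x^T *m x *m V) = (\sum_i m i * v i 0) ^+ 2.
  have e : \sum_i V i 0 * x 0 i = \sum_i m i * v i 0.
    by rewrite sum_block_col; apply: eq_bigr => i _; rewrite xw mulrC.
  rewrite dot_mulmxE -e expr2 mulr_suml; apply: eq_bigr => i _.
  rewrite mulr_sumr; apply: eq_bigr => j _.
  by rewrite [(_ *m _) i j]mxE big_ord1 [x^T _ _]mxE; ring.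
have t4 : dot V ((\matrix_(i, j) ((i == j)%:R / (1 - x 0 i ^+ 2))) *m V) =
    \sum_i v i 0 ^+ 2 / (1 - m i ^+ 2).
  rewrite {1}/dot sum_block_col; apply: eq_bigr => i _; rewrite mxE.
  rewrite (bigD1 (widen_ord le_nN i)) //= big1 ?addr0 => [|j ji]; last first.
    by rewrite mxE eq_sym (negbTE ji) !mul0r.
  by rewrite !mxE eqxx /= ltn_ord (valK i); rewrite -/(m i); ring.
have t3 : beta ^+ 2 * (1 - N%:R^-1 * \sum_i x 0 i ^+ 2) <=
    y ^+ 2 / n%:R * (\sum_i (1 - m i ^+ 2)) + 2 * beta ^+ 2 * kappa.
  have -> : beta ^+ 2 * (1 - N%:R^-1 * \sum_i x 0 i ^+ 2) =
      beta ^+ 2 / N%:R * \sum_i (1 - x 0 i ^+ 2).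
    rewrite sumrB sumr_const card_ord -[1 *+ N]/(N%:R); field; exact: lt0r_neq0.
  rewrite sum_block mulrDr; apply: lerD.
    rewrite y2 le_eqVlt; apply/orP; left; apply/eqP.
    rewrite (eq_bigr (fun i => 1 - m i ^+ 2)); last by move=> i _; rewrite xw.
    by field; rewrite !gt_eqF.
  have hh : \sum_(i < N | ~~ (i < n)%N) (1 - x 0 i ^+ 2) <= N%:R * (2 * kappa).
    rewrite big_mkcond -[N in N%:R]card_ord mulr_natl -sumr_const /=.
    apply: ler_sum => i _; case: ifPn => [ni|_]; last by rewrite mulr_ge0 // ltW.
    by rewrite mxE (negbTE ni); nra.
  have b0 : 0 <= beta ^+ 2 / N%:R by rewrite divr_ge0 ?sqr_ge0 ?ler0n.
  apply: le_trans (ler_wpM2l b0 hh) _.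
  by rewrite le_eqVlt; apply/orP; left; apply/eqP; field; rewrite gt_eqF.
rewrite t1 t2 t4 VV [beta * (_ * dot _ _)]mulrA -/y.
have := ler_wpM2r (dot_ge0 v) t3.
have -> : 2 * beta ^+ 2 / N%:R = 2 * y ^+ 2 / n%:R.
  by rewrite y2; field; rewrite !gt_eqF.
lra.
Qed.

End Block.

Lemma hessian_TAP_sym (R : realType) N (beta h : R) (g : 'M[R]_N) (x : 'rV[R]_N) :
  (forall i, `|x 0 i| < 1) ->
  (hessian (TAP beta h g) x)^T = hessian (TAP beta h g) x.
Proof.
move=> x1; rewrite hessian_TAP // !linearB !linearD /= !linearZ /= wigner_sym.
rewrite trmx_mul trmxK tr_scalar_mx; congr (_ - _).
apply/matrixP => i j; rewrite !mxE eq_sym.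
by have [->|] := eqVneq i j; rewrite ?mul0r.
Qed.

Lemma block_lambda1_gt (R : realType) N n (le_nN : (n <= N)%N)
    (beta h kappa : R) (g : 'M[R]_N) : (0 < n)%N -> 0 < kappa < 1 ->
  49 / 50 <= beta * (Num.sqrt n%:R / Num.sqrt N%:R) <= 99 / 100 ->
  2 * beta ^+ 2 * kappa <= 1 / 100 ->
  ~ rayleigh_le (2 - 1 / 100) (wigner (block_sub le_nN g)) ->
  exists c, 1 / 100 < lambda1 (hessian (TAP beta h g) (block_profile n kappa c)).
Proof.
move=> n_gt0 k01 hy hk hW.
have [v hv] : exists v : 'cV[R]_n, (2 - 1 / 100) * dot v v <
    dot v (wigner (block_sub le_nN g) *m v).
  by apply: contra_notP hW => /forallNP h' v; rewrite leNgt; apply/negP.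
have v0 : v != 0.
  apply: contraTneq hv => ->.
  by rewrite mulmx0 /dot !big1 ?mulr0 ?ltxx // => i _; rewrite mxE mul0r.
have [a ha] := profile_exists n_gt0 v0 hy hk (ltW hv).
have [c cE] : exists c : {ffun 'I_N -> 'I_4}, a = fun i => c (widen_ord le_nN i).
  exists [ffun i : 'I_N => if insub (i : nat) is Some j then a j else ord0].
  by apply/funext => i; rewrite ffunE (valK i).
rewrite cE in ha.
exists c; apply/lambda1_gt => //.
  by apply: hessian_TAP_sym => i; exact: block_profile_lt1.
move=> /(_ (block_col N v)); apply/negP; rewrite -ltNge.
have -> : dot (block_col N v) (block_col N v) = dot v v.
  rewrite {1}/dot (sum_block_col le_nN); apply: eq_bigr => i _.
  by rewrite mxE (valK i).
by apply: lt_le_trans ha _; exact: block_hessian.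
Qed.

Theorem theorem1p2 (R : realType) :
  exists beta0 : R, 0 < beta0 < 1 /\
  forall (d : measure_display) (T : measurableType d) (P : probability T R)
    (g : forall N : nat, 'I_N -> 'I_N -> {RV P >-> R}),
    (forall N : nat, iid_std_gaussian (@g N)) ->
  forall beta h : R, beta0 < beta -> h != 0 ->
  exists eps : R, 0 < eps /\
  exists m : forall N : nat, 'I_N -> {RV P >-> R},
    let mvec (N : nat) (w : T) : 'rV[R]_N := \row_i m N i w in
    let gmat (N : nat) (w : T) : 'M[R]_N := \matrix_(i, j) g N i j w in
    (forall (N : nat) (w : T), Plefka1 beta (mvec N w)) /\
    (forall (N : nat) (w : T) (i : 'I_N), `|mvec N w 0 i| < 1) /\
    P [set w | eps < lambda1 (hessian (TAP beta h (gmat N w)) (mvec N w))]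
      @[N --> \oo] --> 1%E.
Proof.
(* The block has proportion [rho = (99/100)^2 / beta^2], which is below 1 exactly when
   [beta > 99/100]. *)
exists (99 / 100); split; first by apply/andP; split; lra.
(* [x - eta] must be the level [2 - 1/100] used for the profiles, with [x] still below 2. *)
pose x : R := 2 - 1 / 200; pose eta : R := 1 / 200.
have eta0 : 0 < eta by rewrite /eta; lra.
have etax : eta < x by rewrite /eta /x; lra.
have x2 : x < 2 by rewrite /x; lra.
have xc : 0 < 1 - x ^+ 2 / 4 by rewrite /x; lra.
have x_eta : x - eta = 2 - 1 / 100 by rewrite /x /eta; lra.
move=> d T P g g_iid beta h hbeta _; exists (1 / 100); split; first by lra.
have beta_gt0 : 0 < beta by lra.
have beta2_gt0 : 0 < beta ^+ 2 by rewrite exprn_gt0.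
pose rho : R := (99 / 100) ^+ 2 / beta ^+ 2.
have rho_gt0 : 0 < rho by rewrite divr_gt0 // exprn_gt0.
have rhoE : beta ^+ 2 * rho = (99 / 100) ^+ 2.
  by rewrite /rho mulrC divfK // gt_eqF.
have rho_lt1 : rho < 1.
  rewrite ltr_pdivrMr // mul1r; apply: ltrXn2r => //; rewrite ?nnegrE; lra.
pose nn N := Num.truncn (rho * N%:R).
have nnP N : (nn N)%:R <= rho * N%:R < (nn N)%:R + 1.
  by rewrite natr1; apply: truncn_itv; rewrite mulr_ge0 // ltW.
have le_nn N : (nn N <= N)%N.
  rewrite -(ler_nat R); have /andP[+ _] := nnP N; move/le_trans; apply.
  by rewrite ler_piMl // ltW.
have nn_oo (A : R) : \forall N \near \oo, A <= (nn N)%:R.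
  near=> N; have /andP[_ h1] := nnP N.
  have : (A + 1) / rho <= N%:R by near: N; exact: nbhs_infty_ger.
  by rewrite ler_pdivrMr //; lra.
(* One value serves both needs, [2 beta^2 kappa <= 1/100] and [kappa <= 1/200]. *)
pose kappa : R := (200 * (beta ^+ 2 + 1))^-1.
have K_gt0 : 0 < 200 * (beta ^+ 2 + 1) by rewrite mulr_gt0 // addr_gt0.
have hk : 2 * beta ^+ 2 * kappa <= 1 / 100 by rewrite ler_pdivrMr //; lra.
have k200 : kappa <= 1 / 200 by rewrite -[leLHS]mul1r ler_pdivrMr //; lra.
have k01 : 0 < kappa < 1 by rewrite invr_gt0 K_gt0 /=; lra.
pose gm N w : 'M[R]_N := \matrix_(i, j) g N i j w.
pose prof N (c : {ffun 'I_N -> 'I_4}) := block_profile (nn N) kappa c.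
have prof1 N c i : `|prof N c 0 i| < 1 by exact: block_profile_lt1.
pose Ev N c := [set w | 1 / 100 < lambda1 (hessian (TAP beta h (gm N w)) (prof N c))].
have mEv N c : measurable (Ev N c).
  have -> : Ev N c = ~` [set w | rayleigh_le (1 / 100) (hessian (TAP beta h (gm N w)) (prof N c))].
    by apply/seteqP; split => w /=; move/lambda1_gt; apply => //; exact: hessian_TAP_sym.
  apply: measurableC; apply: measurable_rayleigh_le => i j.
  pose M0 := (2 * beta ^+ 2 / N%:R) *: ((prof N c)^T *m prof N c) +
    (- (beta ^+ 2 * (1 - N%:R^-1 * \sum_(i < N) prof N c 0 i ^+ 2))%:M -
    \matrix_(i, j) ((i == j)%:R / (1 - prof N c 0 i ^+ 2))).
  rewrite (_ : (fun w => _) = fun w => beta * wigner (gm N w) i j + M0 i j).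
    by apply: measurable_funD => //; apply: measurable_funM => //; exact: measurable_wigner.
  by apply/funext => w; rewrite hessian_TAP // -!addrA mxE; congr (_ + _); rewrite mxE.
pose sel N := projT1 (cid (measurable_selection R ([ffun=> ord0] : {ffun 'I_N -> 'I_4}) (mEv N))).
have [sel_m sel_E] : (forall N (F : {ffun 'I_N -> 'I_4} -> R), measurable_fun setT (F \o sel N))
    /\ (forall N w c, Ev N c w -> Ev N (sel N w) w).
  by split => N; have [] := projT2
    (cid (measurable_selection R ([ffun=> ord0] : {ffun 'I_N -> 'I_4}) (mEv N))).
have m_meas N i : measurable_fun setT (fun w => prof N (sel N w) 0 i).
  exact: (sel_m N (fun c => prof N c 0 i)).
exists (fun N i => MeasurableFun.Pack
  (MeasurableFun.Class (isMeasurableFun.Build _ _ _ _ _ (m_meas N i)))).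
move=> mvec gmat.
have mvecE N w : mvec N w = prof N (sel N w) by apply/rowP => i; rewrite [LHS]mxE.
split => [N w|]; first rewrite mvecE.
  apply: block_profile_Plefka1 => //.
  have h1 : beta ^+ 2 * (nn N)%:R / N%:R <= (99 / 100) ^+ 2.
    rewrite -rhoE -mulrA ler_pM2l //.
    have [->|N0] := eqVneq N%:R (0 : R); first by rewrite invr0 mulr0 ltW.
    rewrite ler_pdivrMr ?lt_neqAle 1?eq_sym ?N0 ?ler0n //.
    by have /andP[] := nnP N.
  have h2 : beta ^+ 2 * (2 * kappa) ^+ 2 <= 1 / 100 * (2 * (1 / 200)).
    have -> : beta ^+ 2 * (2 * kappa) ^+ 2 = 2 * beta ^+ 2 * kappa * (2 * kappa) by ring.
    have /andP[k0 _] := k01.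
    by apply: ler_pM; rewrite ?ler_pM2l // ?mulr_ge0 // ltW.
  (* The Plefka sum is at most [9801/10000 + 1/10000]. *)
  by apply: le_lt_trans (lerD h1 h2) _; lra.
split => [N w i|]; first by rewrite mvecE.
pose C : R := 2048 / (eta ^+ 4 * (1 - x ^+ 2 / 4) ^+ 2).
(* The selected profile succeeds as soon as any profile does. *)
have EvE N : [set w | 1 / 100 < lambda1 (hessian (TAP beta h (gmat N w)) (mvec N w))] =
    \bigcup_(c in [set: {ffun 'I_N -> 'I_4}]) Ev N c.
  apply/seteqP; split => w /=.
    by rewrite mvecE => hw; exists (sel N w).
  by move=> [c _ /sel_E]; rewrite mvecE.
apply: (@squeeze_cvge _ _ _ _ (fun N => (1 - C / (nn N)%:R)%:E) _ (fun=> 1%E)); last 2 first.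
- apply: cvg_EFin; first exact: nearW.
  rewrite -[X in _ --> X]subr0; apply: cvgB; first exact: cvg_cst.
  rewrite -[X in _ --> X](mulr0 C); apply: cvgM; first exact: cvg_cst.
  apply/gtr0_cvgV0; last by apply/cvgryPge.
  by near=> N; apply: (@lt_le_trans _ _ 1) => //; near: N; exact: nn_oo.
- exact: cvg_cst.
near=> N.
have mE : measurable [set w | 1 / 100 < lambda1 (hessian (TAP beta h (gmat N w)) (mvec N w))].
  rewrite EvE; apply: fin_bigcup_measurable => // c _; exact: mEv.
rewrite probability_le1 // andbT.
have nn_gt0 : (0 < nn N)%N.
  by rewrite -(ltr0n R); apply: (@lt_le_trans _ _ 1) => //; near: N; exact: nn_oo.
(* Truncation in [nn N] lowers [y^2] by at most [beta^2 / N], and [(99/100)^2 - 1/100] still exceeds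
   [(49/50)^2]. *)
have hN : beta ^+ 2 <= N%:R / 100.
  have : beta ^+ 2 * 100 <= N%:R by near: N; exact: nbhs_infty_ger.
  by rewrite ler_pdivlMr.
have N0 : 0 < N%:R :> R by rewrite ltr0n (leq_trans nn_gt0).
have hy : 49 / 50 <= beta * (Num.sqrt (nn N)%:R / Num.sqrt N%:R) <= 99 / 100.
  have y0 : 0 <= beta * (Num.sqrt (nn N)%:R / Num.sqrt N%:R).
    by rewrite mulr_ge0 ?(ltW beta_gt0) // divr_ge0 ?sqrtr_ge0.
  have y2 : (beta * (Num.sqrt (nn N)%:R / Num.sqrt N%:R)) ^+ 2 =
      beta ^+ 2 * (nn N)%:R / N%:R.
    by rewrite exprMn expr_div_n !sqr_sqrtr ?ler0n // mulrA.
  have /andP[n1 n2] := nnP N.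
  have n1' : beta ^+ 2 * (nn N)%:R <= (99 / 100) ^+ 2 * N%:R.
    by have := ler_wpM2l (ltW beta2_gt0) n1; rewrite mulrA rhoE.
  have n2' : (99 / 100) ^+ 2 * N%:R <= beta ^+ 2 * (nn N)%:R + beta ^+ 2.
    by have := ler_wpM2l (ltW beta2_gt0) (ltW n2); rewrite mulrDr mulr1 mulrA rhoE.
  apply/andP; split; rewrite -(@ler_pXn2r _ 2) ?nnegrE // ?divr_ge0 // y2.
    by rewrite ler_pdivlMr //; lra.
  by rewrite ler_pdivrMr.
pose X i j := g N (widen_ord (le_nn N) i) (widen_ord (le_nn N) j).
have X_iid : iid_std_gaussian X.
  apply: iid_std_gaussian_sub (g_iid N) => i j /(congr1 val) /= ij.
  exact: val_inj.
have hn : 2 * eta^-1 ^+ 2 <= (1 - x ^+ 2 / 4) * (nn N)%:R.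
  by rewrite -ler_pdivrMl //; near: N; exact: nn_oo.
have bad := wigner_rayleigh_tail X_iid eta0 etax x2 nn_gt0 hn.
set A := [set t | _] in bad.
have mA : measurable A.
  by apply: measurable_rayleigh_le => i j; exact: measurable_wigner.
rewrite -/C in bad; apply: (@le_trans _ _ (P (~` A))).
  rewrite probability_setC // -(fineK (fin_num_measure P A mA)) -EFinB lee_fin lerD2l lerN2.
  by rewrite -lee_fin fineK // fin_num_measure.
apply: le_measure; rewrite ?inE //; first exact: measurableC.
rewrite EvE => w /= nAw.
have [c hc] : exists c, Ev N c w.
  apply: (block_lambda1_gt (le_nN := le_nn N)) => //.
  move=> hW; apply: nAw; rewrite /A /= x_eta.
  rewrite (_ : \matrix_(i, j) X i j w = block_sub (le_nn N) (gm N w)) //.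
  by apply/matrixP => i j; rewrite !mxE.
by exists c.
Unshelve. all: by end_near.
Qed.
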